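(* Let $(P,g,\Phi)$ be a Carrollian $\mathbb{R}^\times$-bundle with a connection, and let $L$ be the line bundle with $L^\times=P$. Assume that the local components $g_{ab}(x,t)$ of $g$ extend smoothly to $t=0$, as a non-degenerate matrix. Then the Levi-Civita connection $\nabla$ associated with $g^{(+)}_\omega=g+\omega^2$ provides an affine connection on regular vector fields on the line bundle $L$; that is, for regular vector fields $X,Y$ on $L$, the vector field $\nabla_XY$ on $P$ extends smoothly over the zero section to a regular vector field on $L$, and the resulting operation satisfies the axioms of an affine connection ($C^\infty(L)$-linear in $X$, additive and satisfying the Leibniz rule in $Y$).
   Context: $\mathbb{R}^\times:=\mathbb{R}\setminus\{0\}$ with multiplication. For a real line bundle $L\to M$, $P=L^\times:=L\setminus\{0_M\}$ (zero section removed) is a principal $\mathbb{R}^\times$-bundle $\pi:P\to M$ with action $\mathrm{h}_s$ given by fibrewise multiplication; every principal $\mathbb{R}^\times$-bundle arises from a line bundle in this way. Adapted local coordinates are $(x^a,t)$, with $t$ the linear fibre coordinate ($t\neq0$ on $P$). The Euler vector field $\Delta_P$ is the fundamental vector field of the action, locally $\Delta_P=t\,\partial_t$; it globally generates the module $\mathrm{Sec}(VP)$ of vertical vector fields, $VP=\ker(d\pi)$. A Carrollian $\mathbb{R}^\times$-bundle is a pair $(P,g)$, where $P$ is a principal $\mathbb{R}^\times$-bundle and $g$ is a degenerate metric (smooth symmetric covariant 2-tensor) on the total space $P$ with $\{X\in\mathrm{Vect}(P): g(X,-)=0\}=\mathrm{Sec}(VP)$, understood pointwise: $\ker(g_p)=V_pP$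 for all $p\in P$. Locally $g=g_{ab}(x,t)\,dx^adx^b$ with $(g_{ab})$ invertible. An $\mathbb{R}^\times$-connection on $P$ is a smooth vector bundle map $\Phi:TP\to TP$ over $P$ with $\Phi\circ\Phi=\Phi$, $\mathrm{Im}\,\Phi=VP$, and $(T\mathrm{h}_s)\circ\Phi=\Phi\circ(T\mathrm{h}_s)$ for all $s\in\mathbb{R}^\times$. Its connection one-form $\omega$ is the real-valued one-form defined by $\Phi(X)=\omega(X)\Delta_P$; locally $\omega=t^{-1}dt+A_a(x)\,dx^a$. A Carrollian $\mathbb{R}^\times$-bundle with a connection is a triple $(P,g,\Phi)$ with $(P,g)$ a Carrollian $\mathbb{R}^\times$-bundle and $\Phi$ an $\mathbb{R}^\times$-connection. The tensor $g^{(+)}_\omega=g+\omega\otimes\omega$ is a non-degenerate metric on $P$. A vector field on $L$ is regular if its components in the adapted coordinates $(x^a,t)$ (with respect to $\partial_{x^a},\partial_t$) are at least linear in $t$ near the zero section, i.e. vanish at $t=0$; the zero vector field is included. *)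

(* Defs.v *)
From HB Require Import structures.
From mathcomp Require Import all_boot all_order all_algebra.
From mathcomp Require Import all_classical all_reals all_analysis.

Set Implicit Arguments.
Unset Strict Implicit.
Unset Printing Implicit Defensive.

Import Order.TTheory GRing.Theory Num.Theory.
Import numFieldNormedType.Exports.

Local Open Scope classical_set_scope.
Local Open Scope ring_scope.

(* C^k and C^oo maps on an open set O of a finite-dimensional space: all
   iterated directional derivatives exist and are (Frechet) differentiable. *)
Fixpoint Ck_on (R : realType) (E F : normedModType R) (k : nat) (O : set E)
    (f : E -> F) : Prop :=
  match k with
  | 0%N => forall x, O x -> {for x, continuous f}
  | k'.+1 => (forall x, O x -> differentiable f x) /\
             (forall v : E, Ck_on k' O (fun x => 'D_v f x))
  end.

Definition smooth_on (R : realType) (E F : normedModType R) (O : set E)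
    (f : E -> F) : Prop := forall k : nat, Ck_on k O f.

(* Smooth manifolds modelled on E.  [coord i] is a chart with domain [dom i];
   [icoord i] is its inverse, meaningful only on the open set
   [coord i @` dom i].  The covering condition is given by the choice of a
   preferred chart [chart_at p] around every point p. *)
Record manifold (R : realType) (E : normedModType R) := Manifold {
  points :> topologicalType;
  chart : Type;
  dom : chart -> set points;
  coord : chart -> points -> E;
  icoord : chart -> E -> points;
  chart_at : points -> chart;
  manifold_hausdorff : hausdorff_space points;
  manifold_second_countable : @second_countable points;
  dom_chart_at : forall p, dom (chart_at p) p;
  dom_open : forall i, open (dom i);
  codom_open : forall i, open (coord i @` dom i);
  coordK : forall i p, dom i p -> icoord i (coord i p) = p;
  coord_continuous : forall i p, dom i p -> {for p, continuous (coord i)};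
  icoord_continuous : forall i q, (coord i @` dom i) q ->
    {for q, continuous (icoord i)};
  transition_smooth : forall i j,
    smooth_on (coord i @` (dom i `&` dom j)) (coord j \o icoord i)
}.

Arguments dom {R E m} _.
Arguments coord {R E m} _ _.
Arguments icoord {R E m} _ _.
Arguments chart_at {R E m} _.

Section Manifolds.
Variables (R : realType) (E : normedModType R) (X : manifold E).
Implicit Types (O : set X) (p : X) (i : chart X).

Definition smooth_fun (F : normedModType R) O (f : X -> F) : Prop :=
  forall i, smooth_on (coord i @` (dom i `&` O)) (f \o icoord i).

(* The tangent space at p is the model space E: a tangent vector is identified
   with its components in the preferred chart at p.  [to_chart i p] gives the
   components in the chart i of a tangent vector at p, and [of_chart i p] is
   the tangent vector at p with given components in the chart i (both for
   p in [dom i]). *)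
Definition to_chart i p : E -> E :=
  'd (coord i \o icoord (chart_at p)) (coord (chart_at p) p).

Definition of_chart i p : E -> E :=
  'd (coord (chart_at p) \o icoord i) (coord i p).

Definition vfield := X -> E.

Definition vcomp i (V : vfield) (q : E) : E :=
  to_chart i (icoord i q) (V (icoord i q)).

(* The vector fields on the open set O, represented on all of X with the
   value 0 outside O, so that equal fields on O are equal functions. *)
Definition Vect O : set vfield :=
  [set V | (forall i, smooth_on (coord i @` (dom i `&` O)) (vcomp i V)) /\
           (forall p, ~ O p -> V p = 0)].

Definition restr_vfield O (V : vfield) : vfield := patch (fun=> 0) O V.

Definition lie_derive (V : vfield) (f : X -> R) : X -> R :=
  fun p => 'd (f \o icoord (chart_at p)) (coord (chart_at p) p) (V p).

Definition is_lie_bracket O (V W Z : vfield) : Prop :=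
  forall f : X -> R, smooth_fun O f -> forall p, O p ->
    lie_derive Z f p =
    lie_derive V (lie_derive W f) p - lie_derive W (lie_derive V f) p.

(* Affine connections on a set V of vector fields which is a module over the
   algebra A of functions. *)
Definition affine_connection (A : set (X -> R)) (V : set vfield)
    (nabla : vfield -> vfield -> vfield) : Prop :=
  (forall U W, V U -> V W -> V (nabla U W)) /\
  (forall U U' W, V U -> V U' -> V W ->
    nabla (fun p => U p + U' p) W = (fun p => nabla U W p + nabla U' W p)) /\
  (forall f U W, A f -> V U -> V W ->
    nabla (fun p => f p *: U p) W = (fun p => f p *: nabla U W p)) /\
  (forall U W W', V U -> V W -> V W' ->
    nabla U (fun p => W p + W' p) = (fun p => nabla U W p + nabla U W' p)) /\
  (forall f U W, A f -> V U -> V W ->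
    nabla U (fun p => f p *: W p) =
    (fun p => lie_derive U f p *: W p + f p *: nabla U W p)).

Definition tensor2 := X -> E -> E -> R.

Definition tcomp i (g : tensor2) (u v : E) (q : E) : R :=
  g (icoord i q) (of_chart i (icoord i q) u) (of_chart i (icoord i q) v).

Definition symmetric_tensor O (g : tensor2) : Prop :=
  [/\ forall p, O p -> forall u, scalar (g p u),
      forall p, O p -> forall u v, g p u v = g p v u
    & forall i u v, smooth_on (coord i @` (dom i `&` O)) (tcomp i g u v)].

Definition torsion_free O (nabla : vfield -> vfield -> vfield) : Prop :=
  forall U W, Vect O U -> Vect O W ->
    is_lie_bracket O U W (fun p => nabla U W p - nabla W U p).

Definition metric_compatible O (g : tensor2)
    (nabla : vfield -> vfield -> vfield) : Prop :=
  forall U V W, Vect O U -> Vect O V -> Vect O W -> forall p, O p ->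
    lie_derive U (fun q => g q (V q) (W q)) p =
    g p (nabla U V p) (W p) + g p (V p) (nabla U W p).

Definition levi_civita O (g : tensor2)
    (nabla : vfield -> vfield -> vfield) : Prop :=
  [/\ affine_connection (smooth_fun O) (Vect O) nabla,
      torsion_free O nabla & metric_compatible O g nabla].

End Manifolds.

Definition tangent_map (R : realType) (E F : normedModType R)
    (X : manifold E) (Y : manifold F) (f : X -> Y) (p : X) : E -> F :=
  'd (coord (chart_at (f p)) \o f \o icoord (chart_at p))
     (coord (chart_at p) p).

(* A real line bundle over an n-dimensional manifold, with an atlas of adapted
   charts (x, t) : [coord i p].1 are the coordinates x of the base point in the
   base chart [bchart i], and [coord i p].2 is the fibre coordinate t, which is
   homogeneous for the fibrewise multiplication [hmul].  In rank one,
   homogeneity makes the changes of t linear on fibres, hence the addition on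
   the fibres is determined by [hmul] and need not be recorded. *)
Record line_bundle (R : realType) (n : nat) := LineBundle {
  base : manifold 'rV[R]_n;
  total :> manifold ('rV[R]_n * R)%type;
  proj : total -> base;
  hmul : R -> total -> total;
  bchart : chart total -> chart base;
  bchart_cover : forall x : base, exists i, dom (bchart i) x;
  dom_proj : forall i, dom i = proj @^-1` dom (bchart i);
  coord_proj : forall i p, dom i p ->
    (coord i p).1 = coord (bchart i) (proj p);
  fibre_onto : forall i x (t : R), dom (bchart i) x ->
    exists p : total, proj p = x /\ (coord i p).2 = t;
  proj_hmul : forall s p, proj (hmul s p) = proj p;
  coord_hmul : forall i s p, dom i p ->
    (coord i (hmul s p)).2 = s * (coord i p).2
}.

Arguments hmul {R n} _ _ _.
Arguments proj {R n} _ _.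

Section Carroll.
Variables (R : realType) (n : nat) (L : line_bundle R n).
Local Notation E := ('rV[R]_n * R)%type.

Definition zero_section : set L := range (hmul L 0).

(* The principal bundle P = L^x; its structure group acts by [hmul s],
   s != 0. *)
Definition punctured : set L := ~` zero_section.

Definition vertical (p : L) : set E :=
  [set v | tangent_map (proj L) p v = 0].

(* Fundamental vector field of the action: s |-> s p differentiated at 1. *)
Definition euler (p : L) : E :=
  derive1 (fun s : R => (coord (chart_at p) (hmul L s p) : E)) 1.

Definition carrollian (g : tensor2 L) : Prop :=
  symmetric_tensor punctured g /\
  forall p, punctured p -> [set v | forall w, g p v w = 0] = vertical p.

Definition smooth_bundle_map (O : set L) (Phi : L -> E -> E) : Prop :=
  (forall p, O p -> linear (Phi p)) /\
  (forall i u, smooth_on (coord i @` (dom i `&` O))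
     (fun q : E => to_chart i (icoord i q)
        (Phi (icoord i q) (of_chart i (icoord i q) u)))).

Definition Rx_connection (Phi : L -> E -> E) : Prop :=
  [/\ smooth_bundle_map punctured Phi,
      forall p, punctured p -> forall v, Phi p (Phi p v) = Phi p v,
      forall p, punctured p -> range (Phi p) = vertical p
    & forall s : R, s != 0 -> forall p, punctured p -> forall v,
        tangent_map (hmul L s) p (Phi p v) =
        Phi (hmul L s p) (tangent_map (hmul L s) p v)].

Definition connection_form (Phi : L -> E -> E) (omega : L -> E -> R) : Prop :=
  forall p, punctured p -> forall v, Phi p v = omega p v *: euler p.

Definition g_plus (g : tensor2 L) (omega : L -> E -> R) : tensor2 L :=
  fun p v w => g p v w + omega p v * omega p w.

(* The matrix g_ab(x, t) of the components along d/dx^a, d/dx^b. *)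
Definition gab (i : chart L) (g : tensor2 L) (q : E) : 'M[R]_n :=
  \matrix_(a < n, b < n) tcomp i g (delta_mx 0 a, 0) (delta_mx 0 b, 0) q.

Definition extends_nondegenerately (g : tensor2 L) : Prop :=
  forall i : chart L, exists G : E -> 'M[R]_n,
    [/\ forall a b, smooth_on (coord i @` dom i) (fun q => G q a b),
        forall q, (coord i @` dom i) q -> q.2 != 0 -> G q = gab i g q
      & forall q, (coord i @` dom i) q -> q.2 = 0 -> G q \in unitmx].

Definition regular : set (vfield L) :=
  [set V | Vect setT V /\
    forall i (q : E), (coord i @` dom i) q -> q.2 = 0 -> vcomp i V q = 0].

End Carroll.

(* Main.v *)
Require Import Defs.
From HB Require Import structures.
From mathcomp Require Import all_boot all_order all_algebra.
From mathcomp Require Import all_classical all_reals all_analysis.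
From mathcomp Require Import ring lra.
Import Defs.
Import Order.TTheory GRing.Theory Num.Theory.
Import numFieldNormedType.Exports.
Local Open Scope classical_set_scope.
Local Open Scope ring_scope.

Set Implicit Arguments.
Unset Strict Implicit.
Unset Printing Implicit Defensive.

(** In an adapted chart (x, t) the connection form is dt/t + A_a(x) dx^a, so the
    metric g + omega^2 has poles along the zero section t = 0, and so have its
    Christoffel symbols for the coordinate fields.  The theorem holds because
    these poles disappear in the frame made of the horizontal lifts
    e_b = d/dx^b - t A_b d/dt and of the Euler field t d/dt: there the matrix of
    g + omega^2 is the block matrix of (g_ab) and 1, which extends smoothly and
    invertibly to t = 0 by hypothesis, and the brackets of the frame are given by
    the curvature of the connection.  A regular field has components in this frame
    that are smooth up to t = 0: its fibre component is divisible by t, with a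
    smooth quotient, by Hadamard's lemma.

    The argument is carried out in one chart at a time.  Koszul's formula with
    locally constant test fields ([koszul_chart]) expresses
    g + omega^2 (nabla_X Y - D_X Y, u) through first derivatives of the metric
    only.  For g + omega^2 its right-hand side is computed in
    [koszul_plus_form]: since dt/t is closed, the poles that remain are those of
    omega(X) and omega(Y), and of the symmetrized derivative of omega on X and
    Y, which disappear once the fibre components of X and Y are written as t
    times smooth functions.  Taking for u the frame above, [covariant_extension] solves for
    nabla_X Y and finds a map that is smooth on the whole chart and vanishes at
    t = 0.  Hence nabla_X Y, extended by zero, is regular, and the axioms of a
    connection pass to the extension, both sides being zero at t = 0.

    Four ingredients support this.  Division by t ([hadamard_division]) writes
    the quotient as an integral along the fibre and differentiates under the
    integral sign.  The connection nabla and the Lie bracket are operations on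
    fields and functions over all of P, so evaluating them in a chart requires
    bump functions ([bump_exists]), by which constant fields and coordinate
    functions are extended from a chart to P ([constant_field_extension],
    [coordinate_extension]).  Invariance under the structure group gives the
    local form of omega ([form_compE]), with coefficients read off on the slice
    t = 1.  Finally the kernel of g being the vertical bundle makes (g_ab)
    invertible away from t = 0 ([gab_unit]). *)

(** * Locality of the differential *)

Section local_differentiability.
Variables (R : realType) (V W : normedModType R).
Implicit Types (f g : V -> W) (x : V).

Lemma near_eq_diff f g x : {near x, f =1 g} -> differentiable f x ->
  differentiable g x /\ 'd g x = 'd f x :> (V -> W).
Proof.
move=> fg /diff_locallyP[cf ef].
have eg : g \o shift x = cst (g x) + 'd f x +o_ 0 id.
  apply/eqaddoP => e e0; move/eqaddoP: ef => /(_ e e0).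
  have fg0 : \forall h \near (0 : V), f (h + x) = g (h + x).
    move: fg; rewrite /prop_near1 => fg.
    have : (h + x) @[h --> (0:V)] --> x.
      rewrite -[X in _ --> X]add0r; apply: cvgD; [exact: cvg_id|exact: cvg_cst].
    by move=> /(_ _ fg).
  apply: filterS2 fg0 => h fgh; rewrite /= !fctE /= fgh.
  by rewrite -(nbhs_singleton fg).
have dgf := diff_unique cf eg.
split; last exact: dgf.
apply/diff_locallyP; split; rewrite dgf; [exact: cf|exact: eg].
Qed.

Lemma open_eq_diff (O : set V) f g x : open O -> O x ->
  (forall y, O y -> f y = g y) -> differentiable f x ->
  differentiable g x /\ 'd g x = 'd f x :> (V -> W).
Proof.
move=> oO Ox fg; apply: near_eq_diff; rewrite /prop_near1.
exact: (filterS fg (open_nbhs_nbhs (conj oO Ox))).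
Qed.

Lemma open_eq_derive (O : set V) f g x v : open O -> O x ->
  (forall y, O y -> f y = g y) -> differentiable f x -> 'D_v g x = 'D_v f x.
Proof.
move=> oO Ox fg df; have [dg e] := open_eq_diff oO Ox fg df.
rewrite (deriveE _ dg) (deriveE _ df).
exact: (congr1 (fun h : V -> W => h v) e).
Qed.

Lemma diff_of_approx f q (l : {linear V -> W}) : continuous l ->
  (forall e, 0 < e -> \forall v \near (0 : V),
     `|f (q + v) - f q - l v| <= e * `|v|) ->
  differentiable f q /\ 'd f q = l :> (V -> W).
Proof.
move=> cl fc.
have eg : f \o shift q = cst (f q) + l +o_ 0 id.
  apply/eqaddoP => e e0; apply: filterS (fc e e0) => v.
  by rewrite /= !fctE /= opprD addrA [v + q]addrC.
have dgf := diff_unique cl eg.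
split; last exact: dgf.
by apply/diff_locallyP; split; rewrite dgf; [exact: cl|exact: eg].
Qed.

Lemma is_derive_line f (a w : V) (c : R) : differentiable f (a + c *: w) ->
  is_derive c 1 (fun r => f (a + r *: w)) ('d f (a + c *: w) w).
Proof.
move=> df; pose p (r : R) := a + r *: w.
have dscal : differentiable (fun r : R => r *: w) c by apply: differentiableZl.
have dp : differentiable p c.
  by apply: differentiableD => //; exact: differentiable_cst.
have dpE : 'd p c 1 = w.
  rewrite /p diffD; [|exact: differentiable_cst|exact: dscal].
  rewrite diff_cst (@diffZl _ _ _ id); last exact: ex_diff.
  have idE : 'd (@id R) c = id :> (R -> R) by exact: diff_val.
  by rewrite idE -[LHS]/(0 + 1 *: w) add0r scale1r.
have dfp : differentiable (f \o p) c by exact: differentiable_comp.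
apply: DeriveDef; first exact: diff_derivable.
by rewrite [LHS](deriveE _ dfp) (@diff_comp _ _ _ _ p f)//= dpE.
Qed.

Lemma near_normE x (P : set V) :
  (\forall y \near x, P y) <->
  exists2 r : R, 0 < r & forall v, `|v| < r -> P (x + v).
Proof.
split=> [/nbhs_normP[r /= r0 rP]|[r r0 rP]].
  exists r => // v vr; apply: rP.
  by rewrite /ball_ /= opprD addrA subrr sub0r normrN.
apply/nbhs_normP; exists r => //= y; rewrite /ball_ /= distrC => yr.
by rewrite -[y](subrKC x); exact: rP.
Qed.

End local_differentiability.

(** * Calculus of smooth maps on open sets *)

Section Ck_calculus.
Variables (R : realType).
Implicit Types (E F G : normedModType R).

Lemma Ck_onW E F k (O : set E) (f : E -> F) : Ck_on k.+1 O f -> Ck_on k O f.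
Proof.
elim: k f => [|k IH] f [df Df]; first by move=> x /df /differentiable_continuous.
by split=> // v; apply: IH; exact: Df.
Qed.

Lemma smooth_diff E F (O : set E) (f : E -> F) x :
  smooth_on O f -> O x -> differentiable f x.
Proof. by move=> /(_ 1%N)[+ _]; apply. Qed.

Lemma smooth_derive E F (O : set E) (f : E -> F) v :
  smooth_on O f -> smooth_on O ('D_v f).
Proof. by move=> sf k; have [_] := sf k.+1; apply. Qed.

Lemma Ck_on_sub E F k (O O' : set E) (f : E -> F) :
  O' `<=` O -> Ck_on k O f -> Ck_on k O' f.
Proof.
move=> sO; elim: k f => [|k IH] f; first by move=> cf x /sO /cf.
by move=> [df Df]; split=> [x /sO /df //|v]; apply: IH; exact: Df.
Qed.

Lemma smooth_on_sub E F (O O' : set E) (f : E -> F) :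
  O' `<=` O -> smooth_on O f -> smooth_on O' f.
Proof. by move=> sO sf k; exact: Ck_on_sub sO (sf k). Qed.

Lemma Ck_on_setU E F k (A B : set E) (f : E -> F) :
  Ck_on k A f -> Ck_on k B f -> Ck_on k (A `|` B) f.
Proof.
elim: k f => [|k IH] f /=; first by move=> fA fB x []; [exact: fA|exact: fB].
move=> [dA DA] [dB DB]; split=> [x []|v]; [exact: dA|exact: dB|].
exact: IH.
Qed.

Lemma smooth_on_setU E F (A B : set E) (f : E -> F) :
  smooth_on A f -> smooth_on B f -> smooth_on (A `|` B) f.
Proof. by move=> fA fB k; exact: Ck_on_setU. Qed.

(** Smoothness is local: every iterated derivative at a point of an open set
    only sees the map on that set.  This lets a candidate formula replace the
    map itself wherever smoothness is to be checked. *)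
Lemma Ck_on_eq E F k (O : set E) (f g : E -> F) : open O ->
  (forall x, O x -> f x = g x) -> Ck_on k O f -> Ck_on k O g.
Proof.
move=> oO; elim: k f g => [|k IH] f g fg.
  move=> cf x Ox; have fgx : {near x, f =1 g}.
    exact: (filterS fg (open_nbhs_nbhs (conj oO Ox))).
  rewrite /prop_for /continuous_at -(fg x Ox).
  apply: (cvg_trans _ (cf x Ox)).
  exact: (near_eq_cvg fgx).
move=> [df Df]; split=> [x Ox|v].
  by have [] := open_eq_diff oO Ox fg (df x Ox).
apply: IH (Df v) => x Ox.
exact/esym/(open_eq_derive _ oO Ox fg (df x Ox)).
Qed.

Lemma smooth_on_eq E F (O : set E) (f g : E -> F) : open O ->
  (forall x, O x -> f x = g x) -> smooth_on O f -> smooth_on O g.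
Proof. by move=> oO fg sf k; exact: Ck_on_eq oO fg (sf k). Qed.

Lemma Ck_on_cst E F k (O : set E) (a : F) : Ck_on k O (fun=> a).
Proof.
elim: k a => [|k IH] a; first by move=> x _; exact: cst_continuous.
split=> [x _|v]; first exact: differentiable_cst.
have -> : 'D_v (fun=> a) = (fun=> 0) :> (E -> F).
  by apply/funext => x; exact: derive_cst.
exact: IH.
Qed.

Lemma smooth_on_cst E F (O : set E) (a : F) : smooth_on O (fun=> a).
Proof. by move=> k; exact: Ck_on_cst. Qed.

Lemma smooth_on_lin E F (O : set E) (l : {linear E -> F}) :
  continuous l -> smooth_on O l.
Proof.
move=> cl [|k]; first by move=> x _; exact: cl.
split=> [x _|v]; first exact: linear_differentiable.
have -> : 'D_v l = (fun=> l v).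
  apply/funext => x; rewrite deriveE ?diff_lin//.
  exact: linear_differentiable.
exact: Ck_on_cst.
Qed.

Lemma Ck_onD E F k (O : set E) (f g : E -> F) : open O ->
  Ck_on k O f -> Ck_on k O g -> Ck_on k O (fun x => f x + g x).
Proof.
move=> oO; elim: k f g => [|k IH] f g.
  by move=> cf cg x Ox; apply: continuousD; [exact: cf|exact: cg].
move=> [df Df] [dg Dg]; split=> [x Ox|v].
  by apply: differentiableD; [exact: df|exact: dg].
apply: (Ck_on_eq oO _ (IH _ _ (Df v) (Dg v))) => x Ox.
by rewrite -deriveD//; apply: diff_derivable; [exact: df|exact: dg].
Qed.

Lemma smooth_onD E F (O : set E) (f g : E -> F) : open O ->
  smooth_on O f -> smooth_on O g -> smooth_on O (fun x => f x + g x).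
Proof. by move=> oO sf sg k; exact: Ck_onD. Qed.

Lemma Ck_onM E k (O : set E) (f g : E -> R) : open O ->
  Ck_on k O f -> Ck_on k O g -> Ck_on k O (fun x => f x * g x).
Proof.
move=> oO; elim: k f g => [|k IH] f g.
  by move=> cf cg x Ox; apply: continuousM; [exact: cf|exact: cg].
move=> Cf Cg; have [df Df] := Cf; have [dg Dg] := Cg; split=> [x Ox|v].
  by apply: differentiableM; [exact: df|exact: dg].
have Cfg := IH _ _ (Ck_onW Cf) (Dg v); have Cgf := IH _ _ (Ck_onW Cg) (Df v).
apply: (Ck_on_eq oO _ (Ck_onD oO Cfg Cgf)) => x Ox.
rewrite -[RHS]/('D_v (f * g) x) deriveM//.
  by apply: diff_derivable; exact: df.
by apply: diff_derivable; exact: dg.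
Qed.

Lemma smooth_onM E (O : set E) (f g : E -> R) : open O ->
  smooth_on O f -> smooth_on O g -> smooth_on O (fun x => f x * g x).
Proof. by move=> oO sf sg k; exact: Ck_onM. Qed.

Lemma Ck_onZl E F k (O : set E) (f : E -> R) (a : F) : open O ->
  Ck_on k O f -> Ck_on k O (fun x => f x *: a).
Proof.
move=> oO; elim: k f => [|k IH] f.
  by move=> cf x Ox; apply: continuousZl; exact: cf.
move=> [df Df]; split=> [x Ox|v]; first by apply: differentiableZl; exact: df.
apply: (Ck_on_eq oO _ (IH _ (Df v))) => x Ox.
rewrite [RHS]deriveE; last by apply: differentiableZl; exact: df.
by rewrite diffZl ?deriveE//; exact: df.
Qed.

Lemma smooth_onZl E F (O : set E) (f : E -> R) (a : F) : open O ->
  smooth_on O f -> smooth_on O (fun x => f x *: a).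
Proof. by move=> oO sf k; exact: Ck_onZl. Qed.

Lemma Ck_onV E k (O : set E) (f : E -> R) : open O ->
  (forall x, O x -> f x != 0) ->
  Ck_on k O f -> Ck_on k O (fun x => (f x)^-1).
Proof.
move=> oO f0; elim: k => [|k IH].
  by move=> cf x Ox; apply: continuousV; [exact: f0|exact: cf].
move=> Cf; have [df Df] := Cf; split=> [x Ox|v].
  by apply: differentiableV; [exact: df|exact: f0].
have IHf := IH (Ck_onW Cf).
have C1 := Ck_onM oO (Ck_onM oO IHf IHf) (Df v).
apply: (Ck_on_eq oO _ (Ck_onM oO (Ck_on_cst _ O (-1 : R)) C1)) => x Ox.
have dfx := df x Ox.
rewrite [RHS]deriveV; [|exact: f0|exact: diff_derivable].
by rewrite mulN1r -invfM -expr2 /GRing.scale /= mulNr.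
Qed.

Lemma smooth_onV E (O : set E) (f : E -> R) : open O ->
  (forall x, O x -> f x != 0) ->
  smooth_on O f -> smooth_on O (fun x => (f x)^-1).
Proof. by move=> oO f0 sf k; exact: Ck_onV. Qed.

Lemma smooth_on_sum E F (I : Type) (r : seq I) (P : pred I) (O : set E)
    (f : I -> E -> F) : open O ->
  (forall i, P i -> smooth_on O (f i)) ->
  smooth_on O (fun x => \sum_(i <- r | P i) f i x).
Proof.
move=> oO sf; elim: r => [|i r IH].
  apply: (smooth_on_eq oO _ (@smooth_on_cst E F O 0)) => x _; by rewrite big_nil.
case Pi : (P i).
  apply: (smooth_on_eq oO _ (smooth_onD oO (sf i Pi) IH)) => x _.
  by rewrite big_cons Pi.
by apply: (smooth_on_eq oO _ IH) => x _; rewrite big_cons Pi.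
Qed.

Lemma smooth_on_prod E (I : Type) (r : seq I) (P : pred I) (O : set E)
    (f : I -> E -> R) : open O ->
  (forall i, P i -> smooth_on O (f i)) ->
  smooth_on O (fun x => \prod_(i <- r | P i) f i x).
Proof.
move=> oO sf; elim: r => [|i r IH].
  apply: (smooth_on_eq oO _ (@smooth_on_cst E R O 1)) => x _; by rewrite big_nil.
case Pi : (P i).
  apply: (smooth_on_eq oO _ (smooth_onM oO (sf i Pi) IH)) => x _.
  by rewrite big_cons Pi.
by apply: (smooth_on_eq oO _ IH) => x _; rewrite big_cons Pi.
Qed.

Lemma smooth_onZc E F (O : set E) (f : E -> F) (c : R) : open O ->
  smooth_on O f -> smooth_on O (fun x => c *: f x).
Proof.
move=> oO sf k; have : Ck_on k O f by exact: sf.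
elim: k f {sf} => [|k IH] f.
  by move=> cf x Ox; apply: continuousZr; exact: cf.
move=> [df Df]; split=> [x Ox|v]; first by apply: differentiableZ; exact: df.
apply: (Ck_on_eq oO _ (IH _ (Df v))) => x Ox.
by rewrite [RHS]deriveZ//; apply: diff_derivable; exact: df.
Qed.

Lemma smooth_onN E F (O : set E) (f : E -> F) : open O ->
  smooth_on O f -> smooth_on O (fun x => - f x).
Proof.
move=> oO /(smooth_onZc (-1) oO); apply: smooth_on_eq => // x _.
by rewrite scaleN1r.
Qed.

Lemma smooth_onB E F (O : set E) (f g : E -> F) : open O ->
  smooth_on O f -> smooth_on O g -> smooth_on O (fun x => f x - g x).
Proof. by move=> oO sf sg; apply: smooth_onD => //; exact: smooth_onN. Qed.

Lemma Ck_on_postlin E F G k (O : set E) (f : E -> F) (l : {linear F -> G}) :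
  open O -> continuous l -> Ck_on k O f -> Ck_on k O (fun x => l (f x)).
Proof.
move=> oO cl; elim: k f => [|k IH] f.
  by move=> cf x Ox; apply: (@continuous_comp _ _ _ f l); [exact: cf|exact: cl].
move=> [df Df]; split=> [x Ox|v].
  apply: (@differentiable_comp _ _ _ _ f l); first exact: df.
  exact: linear_differentiable.
apply: (Ck_on_eq oO _ (IH _ (Df v))) => x Ox.
have dfx := df x Ox; have dl := linear_differentiable (f x) cl.
rewrite [RHS]deriveE; last exact: differentiable_comp.
by rewrite (@diff_comp _ _ _ _ f l)//= diff_lin// deriveE.
Qed.

Lemma smooth_on_postlin E F G (O : set E) (f : E -> F) (l : {linear F -> G}) :
  open O -> continuous l -> smooth_on O f -> smooth_on O (fun x => l (f x)).
Proof. by move=> oO cl sf k; exact: Ck_on_postlin. Qed.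

Lemma smooth_on_affine E F G (O : set F) (O' : set E) (f : F -> G)
    (l : {linear E -> F}) (b : F) :
  open O' -> continuous l -> (forall x, O' x -> O (l x + b)) ->
  smooth_on O f -> smooth_on O' (fun x => f (l x + b)).
Proof.
move=> oO' cl lO sf k; have : Ck_on k O f by exact: sf.
have ca x : {for x, continuous (fun x => l x + b)}.
  by apply: continuousD; [exact: cl|exact: cst_continuous].
elim: k f {sf} => [|k IH] f.
  move=> cf x Ox; apply: (@continuous_comp _ _ _ (fun x => l x + b) f) => //.
  by apply: cf; exact: lO.
pose a x := l x + b.
have da x : differentiable a x.
  by apply: differentiableD => //; exact: linear_differentiable.
move=> [df Df]; split=> [x Ox|v].
  by apply: (@differentiable_comp _ _ _ _ a f) => //; exact/df/lO.
apply: (Ck_on_eq oO' _ (IH _ (Df (l v)))) => x Ox.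
have dfx := df _ (lO _ Ox).
rewrite [RHS]deriveE; last exact: (@differentiable_comp _ _ _ _ a f).
rewrite (@diff_comp _ _ _ _ a f)//= deriveE//; congr ('d f _ _).
have dlx := linear_differentiable x cl.
rewrite diffD// diff_cst diff_lin//.
exact/esym/(addr0 (l v)).
Qed.

End Ck_calculus.

(** * Coordinates on the model space *)

Section model_space.
Variables (R : realType) (n : nat).
Local Notation E := ('rV[R]_n * R)%type.

(** The index [Some a] is the base direction [a], and [None] is the fibre
    direction. *)
Definition pbasis (j : option 'I_n) : E :=
  if j is Some a then (delta_mx 0 a, 0) else (0, 1).

Definition pcoord (j : option 'I_n) (v : E) : R :=
  if j is Some a then v.1 0 a else v.2.

Fact pcoord_is_linear j : linear (pcoord j).
Proof. by case: j => [a|] k u v //=; rewrite !mxE. Qed.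

HB.instance Definition _ j :=
  GRing.isLinear.Build R E R _ (pcoord j) (pcoord_is_linear j).

Lemma continuous_fst : continuous (fst : E -> 'rV[R]_n).
Proof. by move=> x; exact: cvg_fst. Qed.

Lemma continuous_snd : continuous (snd : E -> R).
Proof. by move=> x; exact: cvg_snd. Qed.

Lemma pcoord_continuous j : continuous (pcoord j).
Proof.
case: j => [a|] x /=; last exact: continuous_snd.
apply: (@continuous_comp _ _ _ fst (fun v : 'rV[R]_n => v 0 a)).
  exact: continuous_fst.
exact: matrix_normedtype.coord_continuous.
Qed.

Lemma big_option (V : zmodType) (F : option 'I_n -> V) :
  \sum_j F j = \sum_(a < n) F (Some a) + F None.
Proof.
rewrite (bigD1 None)//= addrC; congr (_ + _).
rewrite (reindex_omap Some id)/=; first by apply: eq_bigl => a; rewrite eqxx.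
by case.
Qed.

Lemma pbasisE (v : E) : v = \sum_j pcoord j v *: pbasis j.
Proof.
have pair_sum (u : 'I_n -> 'rV[R]_n) :
    \sum_a ((u a, 0) : E) = (\sum_a u a, 0).
  elim/big_ind2 : _ => // x y x' y' -> ->.
  by rewrite -[LHS]/(_ + _, 0 + 0) addr0.
rewrite big_option /= (eq_bigr (fun a => ((v.1 0 a *: delta_mx 0 a, 0) : E))).
  rewrite pair_sum -row_sum_delta.
  rewrite -[RHS]/(v.1 + v.2 *: 0, 0 + v.2 *: 1) scaler0 addr0 add0r.
  by rewrite /GRing.scale/= mulr1 -surjective_pairing.
by move=> a _; rewrite -[LHS]/(_ *: _, v.1 0 a *: 0) scaler0.
Qed.

Lemma eq_pcoord (u v : E) : (forall j, pcoord j u = pcoord j v) -> u = v.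
Proof.
by move=> uv; rewrite [u]pbasisE [v]pbasisE; apply: eq_bigr => j _; rewrite uv.
Qed.

Lemma pcoord_norm j (v : E) : `|pcoord j v| <= `|v|.
Proof.
rewrite prod_normE; case: j => [a|] /=; rewrite le_max; apply/orP; [left|by right].
rewrite [leRHS]/Num.norm /= mx_normrE.
exact: (le_bigmax _ (fun ij => `|v.1 ij.1 ij.2|) (0, a)).
Qed.

Lemma norm_le_pcoord (v : E) k : 0 <= k ->
  (forall j, `|pcoord j v| <= k) -> `|v| <= k.
Proof.
move=> k0 vk; rewrite prod_normE ge_max; apply/andP; split; last exact: (vk None).
rewrite [leLHS]/Num.norm /= mx_normrE.
apply: bigmax_le => // -[i a] _ /=; rewrite (ord1 i); exact: (vk (Some a)).
Qed.

Section linear_functions.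
Variables (V : lmodType R) (f : E -> V).
Hypothesis lf : linear f.

Lemma linearE0 : f 0 = 0.
Proof. by have := lf (-1) 0 0; rewrite scaler0 addr0 scaleN1r addNr. Qed.

Lemma linearE_scale a v : f (a *: v) = a *: f v.
Proof. by have := lf a v 0; rewrite linearE0 !addr0. Qed.

Lemma linearE_add u v : f (u + v) = f u + f v.
Proof. by have := lf 1 u v; rewrite !scale1r. Qed.

Lemma linearE_sub u v : f (u - v) = f u - f v.
Proof. by rewrite -[- v]scaleN1r linearE_add linearE_scale scaleN1r. Qed.

Lemma linear_pbasis v : f v = \sum_j pcoord j v *: f (pbasis j).
Proof.
rewrite {1}[v]pbasisE; elim/big_ind2 : _ => [|x y x' y' <- <-|j _].
- exact: linearE0.
- exact: linearE_add.
- exact: linearE_scale.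
Qed.

End linear_functions.

Variable (D : normedModType R).

Lemma smooth_on_pcoord (O : set D) (f : D -> E) j : open O ->
  smooth_on O f -> smooth_on O (fun x => pcoord j (f x)).
Proof. by move=> oO; apply: smooth_on_postlin => //; exact: pcoord_continuous. Qed.

Lemma smooth_on_pcoordP (O : set D) (f : D -> E) : open O ->
  (forall j, smooth_on O (fun x => pcoord j (f x))) -> smooth_on O f.
Proof.
move=> oO sf.
have sfj j : true -> smooth_on O (fun x => pcoord j (f x) *: pbasis j).
  by move=> _; exact: smooth_onZl.
apply: (smooth_on_eq oO _ (smooth_on_sum (index_enum _) oO sfj)) => x Ox.
by rewrite -pbasisE.
Qed.

Lemma diff_pbasis (F : normedModType R) (f : E -> F) x v :
  differentiable f x -> 'd f x v = \sum_j pcoord j v *: 'D_(pbasis j) f x.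
Proof.
move=> df; have l : linear ('d f x) by exact: linearP.
by rewrite (linear_pbasis l); apply: eq_bigr => j _; rewrite deriveE.
Qed.

Lemma diff_pcoord (f : D -> E) x v j : differentiable f x ->
  'd (fun y => pcoord j (f y)) x v = pcoord j ('d f x v).
Proof.
move=> df; have dl := linear_differentiable (f x) (@pcoord_continuous j).
rewrite (@diff_comp _ _ _ _ f (pcoord j))//= diff_lin//.
exact: pcoord_continuous.
Qed.

Lemma derive_pcoord (f : D -> E) x v j : differentiable f x ->
  'D_v (fun y => pcoord j (f y)) x = pcoord j ('D_v f x).
Proof.
move=> df; have dl := linear_differentiable (f x) (@pcoord_continuous j).
have dc : differentiable (fun y => pcoord j (f y)) x.
  exact: (@differentiable_comp _ _ _ _ f (pcoord j)).
by rewrite (deriveE _ df) (deriveE _ dc) diff_pcoord.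
Qed.

(** Chain rule for smooth maps into the model space: expanding the inner
    derivative in the basis leaves sums of products of smooth functions, to
    which the induction on the order of differentiability applies. *)
Lemma smooth_on_comp (O : set D) (O' : set E) (g : D -> E) (f : E -> R) :
  open O -> (forall x, O x -> O' (g x)) ->
  smooth_on O g -> smooth_on O' f -> smooth_on O (fun x => f (g x)).
Proof.
move=> oO gO sg sf k; have : Ck_on k O' f by exact: sf.
elim: k f {sf} => [|k IH] f.
  move=> cf x Ox; apply: (@continuous_comp _ _ _ g f); first exact: (sg 0%N).
  by apply: cf; exact: gO.
move=> [df Df]; have dg x : O x -> differentiable g x by exact: smooth_diff.
split=> [x Ox|v].
  by apply: (@differentiable_comp _ _ _ _ g f); [exact: dg|exact/df/gO].
have sgj j : smooth_on O (fun x => pcoord j ('D_v g x)).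
  by apply: smooth_on_pcoord => //; exact: smooth_derive.
have Ckj : Ck_on k O
    (fun x => \sum_j pcoord j ('D_v g x) * 'D_(pbasis j) f (g x)).
  elim: (index_enum _) => [|j r IHr].
    apply: (Ck_on_eq oO _ (@Ck_on_cst _ D R k O 0)) => x _; by rewrite big_nil.
  have Cj := Ck_onM oO (sgj j k) (IH _ (Df (pbasis j))).
  apply: (Ck_on_eq oO _ (Ck_onD oO Cj IHr)) => x _.
  by rewrite big_cons.
apply: (Ck_on_eq oO _ Ckj) => x Ox.
have dgx := dg _ Ox; have dfx := df _ (gO _ Ox).
rewrite [RHS]deriveE; last exact: (@differentiable_comp _ _ _ _ g f).
rewrite (@diff_comp _ _ _ _ g f)//= diff_pbasis//; apply: eq_bigr => j _.
by rewrite deriveE.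
Qed.

End model_space.

Arguments pbasis {R n} j.
Arguments pcoord {R n} j v.

(** * Hadamard division by the fibre coordinate *)

Section fibre_scaling.
Variables (R : realType) (n : nat).
Local Notation E := ('rV[R]_n * R)%type.

Definition lincomb (c : option 'I_n -> R) (v : E) : R := \sum_j pcoord j v * c j.

Fact lincomb_is_linear c : linear (lincomb c).
Proof.
move=> k u v; rewrite /lincomb /GRing.scale /= mulr_sumr -big_split /=.
by apply: eq_bigr => j _; rewrite linearP mulrDl mulrA.
Qed.

HB.instance Definition _ c :=
  GRing.isLinear.Build R E R _ (lincomb c) (lincomb_is_linear c).

Lemma sum_le_const (F : option 'I_n -> R) k :
  (forall j, F j <= k) -> \sum_j F j <= n.+1%:R * k.
Proof.
move=> Fk; apply: (le_trans (ler_sum _ (fun j _ => Fk j))).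
by rewrite sumr_const card_option card_ord mulr_natl.
Qed.

Lemma lincomb_continuous c : continuous (lincomb c).
Proof.
have sl : smooth_on setT (lincomb c).
  apply: smooth_on_sum => [|j _]; first exact: openT.
  apply: (smooth_onM openT); last exact: smooth_on_cst.
  by apply: smooth_on_lin; exact: pcoord_continuous.
by move=> x; exact: (sl 0%N x I).
Qed.

Lemma diff_intro (f : E -> R) q (c : option 'I_n -> R) :
  (forall e, 0 < e -> \forall v \near (0 : E),
     `|f (q + v) - f q - lincomb c v| <= e * `|v|) ->
  differentiable f q /\ 'd f q = lincomb c :> (E -> R).
Proof.
exact: diff_of_approx (@lincomb_continuous c).
Qed.

(** Fibrewise multiplication in an adapted chart; for [s] in the unit interval
    it joins [q] to its projection on the zero section. *)
Definition squeeze (s : R) (q : E) : E := (q.1, s * q.2).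

Fact squeeze_is_linear s : linear (squeeze s).
Proof.
move=> k u v; rewrite /squeeze; congr pair => /=.
by rewrite mulrDr /GRing.scale /= mulrCA.
Qed.

HB.instance Definition _ s :=
  GRing.isLinear.Build R E E _ (squeeze s) (squeeze_is_linear s).

Lemma squeeze_continuous2 : continuous (fun p : R * E => squeeze p.1 p.2).
Proof.
move=> [s q].
apply: (@cvg_pair _ _ _ (nbhs (s, q)) (nbhs q.1) (nbhs (s * q.2)) _ _ _
  (fun p : R * E => p.2.1) (fun p : R * E => p.1 * p.2.2)).
  apply: (cvg_comp (fun p : R * E => p.2) fst); last exact: continuous_fst.
  exact: cvg_snd.
apply: cvgM; first exact: cvg_fst.
apply: (cvg_comp (fun p : R * E => p.2) snd); last exact: continuous_snd.
exact: cvg_snd.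
Qed.

Lemma squeeze_cts (q : E) : continuous (fun s : R => squeeze s q).
Proof.
move=> s.
apply: (@continuous_comp _ _ _ (fun s : R => (s, q))
  (fun p : R * E => squeeze p.1 p.2)).
  apply: (@cvg_pair _ _ _ (nbhs s) (nbhs s) (nbhs q) _ _ _ id (cst q)).
    exact: cvg_id.
  exact: cvg_cst.
exact: squeeze_continuous2.
Qed.

Lemma squeeze_continuous (s : R) : continuous (squeeze s : E -> E).
Proof.
move=> q.
apply: (@continuous_comp _ _ _ (fun q : E => (s, q))
  (fun p : R * E => squeeze p.1 p.2)).
  apply: (@cvg_pair _ _ _ (nbhs q) (nbhs s) (nbhs q) _ _ _ (cst s) id).
    exact: cvg_cst.
  exact: cvg_id.
exact: squeeze_continuous2.
Qed.

Lemma squeeze_line (q : E) (s : R) : squeeze s q = (q.1, 0) + s *: ((0, q.2) : E).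
Proof.
by rewrite /squeeze -[RHS]/(q.1 + s *: 0, 0 + s * q.2) scaler0 addr0 add0r.
Qed.

Lemma squeeze_norm s v : 0 <= s <= 1 -> `|squeeze s v| <= `|v|.
Proof.
move=> /andP[s0 s1]; rewrite !prod_normE /= ge_max !le_max lexx /=.
apply/orP; right; rewrite normrM ger0_norm//.
by rewrite ler_piMl.
Qed.

Variable O : set E.
Hypothesis oO : open O.
Hypothesis satO : forall q s, O q -> O (squeeze s q).

(** By compactness of the unit interval, continuity is uniform along the segment
    from [q0] to the zero section. *)
Lemma near_squeeze (K : E -> R) q0 e : (forall q, O q -> {for q, continuous K}) ->
  O q0 -> 0 < e -> \forall q \near q0, forall s, `[0%R, 1%R]%classic s ->
    `|K (squeeze s q) - K (squeeze s q0)| < e.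
Proof.
move=> cK Oq0 e0.
have /compact_near_coveringP/(_ E (nbhs q0)) :=
  @segment_compact R 0 1.
apply=> s0 _ /=.
have cs : {for (s0, q0), continuous (fun p : R * E => K (squeeze p.1 p.2))}.
  apply: (@continuous_comp _ _ _ (fun p : R * E => squeeze p.1 p.2) K).
    exact: squeeze_continuous2.
  exact/cK/satO.
have cs0 : {for s0, continuous (fun s : R => K (squeeze s q0))}.
  apply: (@continuous_comp _ _ _ (fun s : R => squeeze s q0) K).
    exact: squeeze_cts.
  exact/cK/satO.
have e2 : 0 < e / 2 by rewrite divr_gt0.
have /cvgrPdist_lt/(_ _ e2) n1 := cs.
have /cvgrPdist_lt/(_ _ e2) n2 := cs0.
have n2' : \forall p \near (s0, q0), `|K (squeeze s0 q0) - K (squeeze p.1 q0)| < e / 2.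
  exact: (@cvg_fst _ _ (nbhs s0) (nbhs q0) _ _ n2).
apply: filterS2 n1 n2' => -[s q] /= h1 h2.
rewrite -(subrKA (K (squeeze s0 q0))) (splitr e).
apply: (le_lt_trans (ler_normD _ _)); apply: ltrD => //.
by rewrite distrC.
Qed.

(** The first order Taylor approximation is uniform along that segment, hence
    survives integration over it.  By the mean value theorem the remainder is a
    variation of the first partial derivatives, which [near_squeeze] bounds. *)
Lemma squeeze_taylor (F : E -> R) q0 e : smooth_on O F -> O q0 -> 0 < e ->
  \forall v \near (0 : E), forall s, `[0%R, 1%R]%classic s ->
    `|F (squeeze s (q0 + v)) - F (squeeze s q0)
       - 'd F (squeeze s q0) (squeeze s v)|
      <= e * `|v|.
Proof.
move=> sF Oq0 e0; have e1 : 0 < e / n.+1%:R by rewrite divr_gt0.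
have nO : \forall q \near q0, O q by exact: open_nbhs_nbhs.
have nDj (j : option 'I_n) :
    \forall q \near q0, forall s, `[0%R, 1%R]%classic s ->
    `|'D_(pbasis j) F (squeeze s q) - 'D_(pbasis j) F (squeeze s q0)|
      < e / n.+1%:R.
  exact: (near_squeeze (smooth_derive _ sF 0%N) Oq0 e1).
have nD := filter_forall (nbhs_filter q0) nDj.
have [r r0 rOD] := (near_normE _ _).1 (filterI nO nD).
apply/near_normE; exists r => // v; rewrite add0r => vr s s01.
have inr c : 0 <= c <= 1 -> `|c *: v| < r.
  move=> /andP[c0 c1]; rewrite normrZ ger0_norm//.
  by apply: le_lt_trans vr; rewrite ler_piMl.
pose p c := squeeze s q0 + c *: squeeze s v.
have pE c : p c = squeeze s (q0 + c *: v) by rewrite /p -linearZ -linearD.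
pose phi c := F (p c).
have Op c : 0 <= c <= 1 -> O (p c).
  by move=> /inr/rOD[Oc _]; rewrite pE; exact: satO.
have dphi (c : R) : 0 <= c <= 1 -> is_derive c 1 phi ('d F (p c) (squeeze s v)).
  by move=> c01; apply: is_derive_line; exact: smooth_diff sF (Op c c01).
have [c c01 phiE] : exists2 c, c \in `[0, 1] &
    phi 1 - phi 0 = 'd F (p c) (squeeze s v) * (1 - 0).
  apply: (@MVT_segment _ _ (fun c => 'd F (p c) (squeeze s v))) => //.
    by move=> c; rewrite in_itv/= => /andP[c0 c1]; apply: dphi; rewrite !ltW.
  apply: continuous_in_subspaceT => c; rewrite inE/= in_itv/= => c01.
  have [dc _] := dphi c c01.
  apply: differentiable_continuous.
  by apply/derivable1_diffP.
rewrite in_itv/= in c01.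
have := phiE; rewrite /phi !pE scale1r scale0r addr0 => ->.
rewrite subr0 mulr1.
have OE : O (squeeze s (q0 + c *: v)) by rewrite -pE; exact: Op.
have d0 := smooth_diff sF (satO s Oq0).
have d1 := smooth_diff sF OE.
rewrite [X in `|X - _|](diff_pbasis _ d1) [X in `|_ - X|](diff_pbasis _ d0).
rewrite -sumrB.
apply: (le_trans (ler_norm_sum _ _ _)).
(* There are n + 1 coordinates; each one gets its share of the error. *)
have -> : e * `|v| = n.+1%:R * (`|v| * (e / n.+1%:R)).
  by rewrite mulrCA [_ * (e / _)]mulrC divfK// mulrC.
apply: sum_le_const => j; rewrite -scalerBr normrM; apply: ler_pM => //.
  exact: (le_trans (pcoord_norm j _) (squeeze_norm _ s01)).
by have [_ /(_ j s s01)/ltW] := rOD _ (inr c c01).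
Qed.

End fibre_scaling.

Section hadamard.
Variables (R : realType) (n : nat).
Local Notation E := ('rV[R]_n * R)%type.
Local Notation mu := (@lebesgue_measure R).

Variable O : set E.
Hypothesis oO : open O.
Hypothesis satO : forall (q : E) s, O q -> O (squeeze s q).

(** The moments of [F] along the segment from the zero section to [q].  The
    moment of order 0 of the fibre derivative of [f] is the Hadamard quotient of
    [f]; the higher orders make the family closed under differentiation. *)
Definition fibre_moment (k : nat) (F : E -> R) (q : E) : R :=
  \int[mu]_(s in `[0%R, 1%R]) (s ^+ k * F (squeeze s q)).

Lemma moment_cts k (F : E -> R) q : smooth_on O F -> O q ->
  continuous (fun s : R => s ^+ k * F (squeeze s q)).
Proof.
move=> sF Oq s.
apply: (@continuousM R R (fun s => s ^+ k)); first exact: exprn_continuous.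
apply: (@continuous_comp _ _ _ (fun s : R => squeeze s q) F).
  exact: squeeze_cts.
exact: (sF 0%N _ (satO _ Oq)).
Qed.

Lemma moment_integrable k (F : E -> R) q : smooth_on O F -> O q ->
  mu.-integrable `[0%R, 1%R] (EFin \o (fun s : R => s ^+ k * F (squeeze s q))).
Proof.
move=> sF Oq; apply: continuous_compact_integrable; first exact: segment_compact.
by apply: continuous_subspaceT; exact: moment_cts.
Qed.

(** Differentiating under the integral, a fibre derivative produces an extra
    factor [s], hence the shift of the order for the index [None]. *)
Definition moment_coef k (F : E -> R) (q : E) (j : option 'I_n) : R :=
  fibre_moment (if j is None then k.+1 else k) ('D_(pbasis j) F) q.

Lemma lincomb_moment k (F : E -> R) q v : smooth_on O F -> O q ->
  [/\ mu.-integrable `[0%R, 1%R]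
        (EFin \o (fun s : R => s ^+ k * 'd F (squeeze s q) (squeeze s v))) &
      \int[mu]_(s in `[0%R, 1%R]) (s ^+ k * 'd F (squeeze s q) (squeeze s v)) =
      lincomb (moment_coef k F q) v].
Proof.
move=> sF Oq.
pose m (j : option 'I_n) (s : R) : R :=
  s ^+ (if j is None then k.+1 else k) * 'D_(pbasis j) F (squeeze s q).
have im j : mu.-integrable `[0%R, 1%R] (EFin \o m j).
  exact: (moment_integrable _ (smooth_derive (pbasis j) sF) Oq).
have Em s : s ^+ k * 'd F (squeeze s q) (squeeze s v) =
    \sum_j pcoord j v * m j s.
  have ds := smooth_diff sF (satO s Oq).
  rewrite [X in _ * X](diff_pbasis _ ds) mulr_sumr; apply: eq_bigr => -[a|] _ /=.
    by rewrite /m mulrCA.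
  by rewrite /m exprS /GRing.scale/=; ring.
have -> : (fun s : R => s ^+ k * 'd F (squeeze s q) (squeeze s v)) =
   (fun s => \sum_j pcoord j v * m j s) by apply/funext.
have mI : measurable (`[0%R, 1%R]%classic : set (measurableTypeR R)) by [].
rewrite /lincomb; elim: (index_enum _) => [|j r [IHi IHe]].
  have -> : (fun s : R => \sum_(j <- [::]) pcoord j v * m j s) = cst 0.
    by apply/funext => s; rewrite big_nil.
  split; first exact: integrable0.
  by rewrite big_nil Rintegral_cst// mul0r.
have -> : (fun s : R => \sum_(j <- j :: r) pcoord j v * m j s) =
    (fun s => pcoord j v * m j s + \sum_(j <- r) pcoord j v * m j s).
  by apply/funext => s; rewrite big_cons.
have iZ : mu.-integrable `[0%R, 1%R] (EFin \o (fun s => pcoord j v * m j s)).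
  by have := integrableZl mI (pcoord j v) (im j).
split; first by have := integrableD mI iZ IHi.
by rewrite RintegralD// IHe RintegralZl// big_cons.
Qed.

Lemma fibre_moment_diff k (F : E -> R) q : smooth_on O F -> O q ->
  differentiable (fibre_moment k F) q /\
  'd (fibre_moment k F) q = lincomb (moment_coef k F q) :> (E -> R).
Proof.
move=> sF Oq; apply: diff_intro => e e0.
have nO : \forall v \near (0 : E), O (q + v).
  have [r r0 rO] := (near_normE q O).1 (open_nbhs_nbhs (conj oO Oq)).
  by apply/near_normE; exists r => // v; rewrite add0r; exact: rO.
apply: filterS2 (squeeze_taylor oO satO sF Oq e0) nO => v tv Oqv.
have mI : measurable (`[0%R, 1%R]%classic : set (measurableTypeR R)) by [].
have [il <-] := lincomb_moment k v sF Oq.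
have i1 := moment_integrable k sF Oqv.
have i2 := moment_integrable k sF Oq.
have i12 : mu.-integrable `[0%R, 1%R] (EFin \o (fun s : R =>
   s ^+ k * F (squeeze s (q + v)) - s ^+ k * F (squeeze s q))).
  have := integrableB mI i1 i2; by [].
have i123 : mu.-integrable `[0%R, 1%R] (EFin \o (fun s : R =>
   s ^+ k * F (squeeze s (q + v)) - s ^+ k * F (squeeze s q)
    - s ^+ k * 'd F (squeeze s q) (squeeze s v))).
  have := integrableB mI i12 il; by [].
rewrite /fibre_moment -RintegralB// -RintegralB//.
apply: (le_trans (le_normr_Rintegral mI i123)).
have -> : e * `|v| = \int[mu]_(s in `[0%R, 1%R]) (e * `|v|).
  have mu01 : mu `[0%R, 1%R]%classic = 1%:E.
    rewrite (@lebesgue_measure_itv R `[0%R, 1%R]) /= lte_fin ltr01.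
    by rewrite -EFinB subr0.
  rewrite (Rintegral_cst _ mI) [X in _ = _ * fine X](_ : _ = 1%:E) ?mulr1//.
apply: le_Rintegral => //.
- have := integrable_norm i123; by [].
- apply: continuous_compact_integrable; first exact: segment_compact.
  by apply: continuous_subspaceT => s; exact: cst_continuous.
move=> s s01; have := tv s s01; move: s01 => /=; rewrite in_itv/= => /andP[s0 s1] {}tv.
rewrite -!mulrBr normrM normrX ger0_norm//.
by apply: le_trans tv; rewrite ler_piMl// exprn_ile1.
Qed.

Lemma fibre_moment_smooth k (F : E -> R) : smooth_on O F ->
  smooth_on O (fibre_moment k F).
Proof.
move=> sF m; elim: m k F sF => [|m IH] k F sF.
  move=> q Oq; apply: differentiable_continuous.
  by have [] := fibre_moment_diff k sF Oq.
split=> [q Oq|v]; first by have [] := fibre_moment_diff k sF Oq.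
have Cm : Ck_on m O (fun q => \sum_j pcoord j v * moment_coef k F q j).
  elim: (index_enum _) => [|j r IHr].
    apply: (Ck_on_eq oO _ (@Ck_on_cst _ E R m O 0)) => x _; by rewrite big_nil.
  have Cj := IH (if j is None then k.+1 else k) _ (smooth_derive (pbasis j) sF).
  have Cvj := Ck_onM oO (Ck_on_cst m O (pcoord j v)) Cj.
  apply: (Ck_on_eq oO _ (Ck_onD oO Cvj IHr)) => x _.
  by rewrite big_cons.
apply: (Ck_on_eq oO _ Cm) => q Oq.
have [d1 d2] := fibre_moment_diff k sF Oq.
rewrite (deriveE _ d1).
exact/esym/(congr1 (fun h : E -> R => h v) d2).
Qed.

(** Integrating the fibre derivative from the zero section to [q] gives
    [f q = q.2 * (fibre_moment 0 ('D_(pbasis None) f) q)]. *)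
Lemma hadamard_division (f : E -> R) : smooth_on O f ->
  (forall q, O q -> q.2 = 0 -> f q = 0) ->
  exists2 h, smooth_on O h & forall q, O q -> f q = q.2 * h q.
Proof.
move=> sf f0; exists (fibre_moment 0 ('D_(pbasis None) f)).
  by apply: fibre_moment_smooth; exact: smooth_derive.
move=> q Oq.
pose w : E := (0, q.2).
have sqE s : squeeze s q = (q.1, 0) + s *: w by exact: squeeze_line.
have dphi (s : R) : is_derive s 1 (fun s => f ((q.1, 0) + s *: w))
    ('d f ((q.1, 0) + s *: w) w).
  by apply: is_derive_line; rewrite -sqE; exact: smooth_diff sf (satO s Oq).
have dw s : 'd f ((q.1, 0) + s *: w) w =
    q.2 * (s ^+ 0 * 'D_(pbasis None) f (squeeze s q)).
  have ds := smooth_diff sf (satO s Oq).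
  rewrite -sqE expr0 mul1r (deriveE _ ds) -[RHS]linearZ; congr ('d f _ _).
  by rewrite /w /pbasis -[RHS]/(_ *: 0, q.2 * 1) scaler0 mulr1.
pose g (s : R) : R := q.2 * (s ^+ 0 * 'D_(pbasis None) f (squeeze s q)).
have ci := moment_integrable 0 (smooth_derive (pbasis None) sf) Oq.
rewrite /fibre_moment -RintegralZl//.
have cg : {within `[0%R, 1%R], continuous g}.
  have cm := moment_cts (k := 0%N) (smooth_derive (pbasis None) sf) Oq.
  have cgT : continuous g.
    move=> s.
    exact: (@continuousM R R (fun=> q.2) _ s (@cst_continuous _ _ q.2 s) (cm s)).
  exact: continuous_subspaceT.
have cphi : continuous (fun s : R => f ((q.1, 0) + s *: w)).
  move=> s; have [ds _] := dphi s.
  by apply: differentiable_continuous; apply/derivable1_diffP.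
have := @continuous_FTC2 R g (fun s => f ((q.1, 0) + s *: w)) 0 1 ltr01 cg.
have e1 : f ((q.1, 0) + 1 *: w) = f q.
  by rewrite -sqE /squeeze mul1r -surjective_pairing.
have e0 : f ((q.1, 0) + 0 *: w) = 0.
  rewrite -sqE; apply: f0; first exact: satO.
  by rewrite /= mul0r.
rewrite e1 e0 sube0 => ftc.
rewrite /Rintegral ftc//.
  split.
  - by move=> s _; have [] := dphi s.
  - by apply: cvg_at_right_filter; exact: cphi.
  - by apply: cvg_at_left_filter; exact: cphi.
move=> s _; rewrite derive1E.
by have := @derive_val _ _ _ _ _ _ _ (dphi s); rewrite dw.
Qed.

End hadamard.

(** * Bump functions *)

Section flat_function.
Variable R : realType.

(** The flat function [exp (-1/x)] times the powers of [1/x].  These products are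
    the terms of its successive derivatives, so that their smoothness is proved
    for all of them in one induction. *)
Definition flat (m : nat) (x : R) : R :=
  if 0 < x then x^-1 ^+ m * expR (- x^-1) else 0.

Lemma flat_le0 m x : x <= 0 -> flat m x = 0.
Proof. by move=> x0; rewrite /flat ltNge x0. Qed.

Lemma flat_gt0 x : 0 < x -> 0 < flat 0 x.
Proof. by move=> x0; rewrite /flat x0 expr0 mul1r expR_gt0. Qed.

Lemma flat_ge0 m x : 0 <= flat m x.
Proof.
rewrite /flat; case: ifPn => // x0.
by rewrite mulr_ge0 ?expR_ge0// exprn_ge0// invr_ge0 ltW.
Qed.

(** The exponential beats every power of [1/x]; the square on the right makes
    the derivative at 0 vanish. *)
Lemma flat_le_sqr m x : flat m x <= (m.+2)`!%:R * x ^+ 2.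
Proof.
have [x0|x0] := leP x 0; first by rewrite flat_le0// mulr_ge0// sqr_ge0.
rewrite /flat x0 expRN -ler_pdivlMr; last by rewrite invr_gt0 expR_gt0.
rewrite invrK.
have y0 : 0 <= x^-1 by rewrite invr_ge0 ltW.
have := expR_ge1Dxn m.+1 y0.
set F := _`!%:R; have F0 : 0 < F :> R by rewrite ltr0n fact_gt0.
move=> h.
have : x^-1 ^+ m.+2 / F <= expR x^-1.
  by apply: le_trans h; rewrite lerDr.
rewrite ler_pdivrMr// => {}h.
have -> : x^-1 ^+ m = x ^+ 2 * x^-1 ^+ m.+2.
  by rewrite !exprS; field; rewrite gt_eqF.
rewrite [F * _]mulrC -[leRHS]mulrA ler_wpM2l ?sqr_ge0//.
by rewrite mulrC.
Qed.

Definition dflat m (x : R) : R := flat m.+2 x - m%:R * flat m.+1 x.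

Lemma flat_diff m x :
  differentiable (flat m) x /\ forall v, 'd (flat m) x v = v * dflat m x.
Proof.
have [x0|x0|->] := ltgtP x 0.
- have dc : differentiable (cst (0 : R) : R -> R) x by exact: differentiable_cst.
  have [d1 d2] := @open_eq_diff R R R [set y | y < 0] (cst 0) (flat m) x
    (@open_lt _ 0) x0 (fun y y0 => esym (flat_le0 m (ltW y0))) dc.
  split=> // v; rewrite d2 diff_cst /dflat !flat_le0 ?ltW//.
  by rewrite mulr0 subr0 mulr0.
- have dg : is_derive x 1 (fun y : R => y^-1 ^+ m * expR (- y^-1)) (dflat m x).
    have xN0 : x != 0 by rewrite gt_eqF.
    have dinv : is_derive x 1 (fun y : R => y^-1) (- x ^- 2).
      have := @is_deriveV R id x 1 1 xN0 (is_derive_id x 1).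
      by rewrite /GRing.scale/= mulr1.
    have dX : is_derive x 1 (fun y : R => y^-1 ^+ m)
        (m%:R * x^-1 ^+ m.-1 * (- x ^- 2)).
      have := @is_deriveX R R (fun y : R => y^-1) m x 1 _ dinv.
      by rewrite exprfctE.
    have dE : is_derive x 1 (fun y : R => expR (- y^-1))
        (expR (- x^-1) * x ^- 2).
      have dN := @is_deriveN R R R (fun y : R => y^-1) x 1 _ dinv.
      rewrite opprK in dN.
      exact: (@is_derive1_comp R expR (fun y : R => - y^-1) x _ _
        (is_derive_expR _) dN).
    have := @is_deriveM R R _ _ x 1 _ _ dX dE.
    congr is_derive; rewrite /dflat /flat x0 /GRing.scale /= -exprVn.
    by case: (m) => [|k]; rewrite /= ?mul0r ?exprS; ring.
  have dgd : differentiable (fun y : R => y^-1 ^+ m * expR (- y^-1)) x.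
    by apply/derivable1_diffP; have [] := dg.
  have fE y : 0 < y -> y^-1 ^+ m * expR (- y^-1) = flat m y by rewrite /flat => ->.
  have [d1 d2] := @open_eq_diff R R R [set y | 0 < y] _ (flat m) x
    (@open_gt _ 0) x0 fE dgd.
  split=> // v; rewrite d2 -[v in LHS]mulr1 -[_ * _]/(v *: 1) linearZ /=.
  by rewrite -(deriveE _ dgd) derive_val.
- have l0 : continuous (\0 : {linear R -> R}) by move=> y; exact: cst_continuous.
  have [|d1 d2] := @diff_of_approx R R R (flat m) 0 (\0 : {linear R -> R}) l0.
    move=> e e0; apply/near_normE; set F : R := (m.+2)`!%:R.
    have F0 : 0 < F by rewrite ltr0n fact_gt0.
    exists (e / F); first by rewrite divr_gt0.
    move=> v; rewrite add0r ltr_pdivlMr// => vF.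
    rewrite add0r (@flat_le0 _ 0)// !subr0 ger0_norm ?flat_ge0//.
    apply: (le_trans (flat_le_sqr m v)); rewrite -(real_normK (num_real v)) expr2 mulrA.
    by rewrite ler_wpM2r// mulrC ltW.
  split=> // v; rewrite d2 /dflat !flat_le0// mulr0 subr0 mulr0.
  by [].
Qed.

Lemma flat_smooth m : smooth_on setT (flat m).
Proof.
move=> k; elim: k m => [|k IH] m.
  by move=> x _; apply: differentiable_continuous; have [] := flat_diff m x.
split=> [x _|v]; first by have [] := flat_diff m x.
have C1 := Ck_onM openT (Ck_on_cst k setT (- (v * m%:R))) (IH m.+1).
have C2 := Ck_onM openT (Ck_on_cst k setT v) (IH m.+2).
apply: (Ck_on_eq openT _ (Ck_onD openT C2 C1)) => x _.
have [d1 d2] := flat_diff m x.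
by rewrite (deriveE _ d1) d2 /dflat; ring.
Qed.


Definition mulc (c x : R) : R := c * x.

Fact mulc_is_linear c : linear (mulc c).
Proof. by move=> k u v; rewrite /mulc mulrDr /GRing.scale/= mulrCA. Qed.

HB.instance Definition _ c :=
  GRing.isLinear.Build R R R _ (mulc c) (mulc_is_linear c).

Lemma mulc_continuous c : continuous (mulc c).
Proof.
by move=> x; apply: continuousM; [exact: cst_continuous|exact: cvg_id].
Qed.

Lemma smooth_on_affine1 (f : R -> R) (c b : R) : smooth_on setT f ->
  smooth_on setT (fun x : R => f (c * x + b)).
Proof.
move=> sf; apply: (smooth_on_affine (l := mulc c) openT _ _ sf) => //.
exact: mulc_continuous.
Qed.

(** A step going from 1 down to 0 between the abscissas 1 and 2. *)
Definition plateau (x : R) : R :=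
  flat 0 (2 - x) / (flat 0 (2 - x) + flat 0 (x - 1)).

Lemma plateau_smooth : smooth_on setT plateau.
Proof.
have s1 : smooth_on setT (fun x : R => flat 0 (2 - x)).
  apply: (smooth_on_eq openT _ (smooth_on_affine1 (-1) 2 (flat_smooth 0))) => x _.
  by rewrite mulN1r addrC.
have s2 : smooth_on setT (fun x : R => flat 0 (x - 1)).
  apply: (smooth_on_eq openT _ (smooth_on_affine1 1 (-1) (flat_smooth 0))) => x _.
  by rewrite mul1r.
apply: (smooth_onM openT s1); apply: (smooth_onV openT) => [x _|]; last first.
  exact: (smooth_onD openT s1 s2).
apply: lt0r_neq0; have [x2|x2] := ltP x 2.
  by apply: ltr_wpDr; [exact: flat_ge0|apply: flat_gt0; rewrite subr_gt0].
apply: ltr_wpDl; [exact: flat_ge0|apply: flat_gt0; rewrite subr_gt0].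
by apply: lt_le_trans x2; rewrite ltr1n.
Qed.

Lemma plateau1 x : x <= 1 -> plateau x = 1.
Proof.
move=> x1; rewrite /plateau (@flat_le0 0 (x - 1)) ?subr_le0// addr0 divff//.
by apply: lt0r_neq0; apply: flat_gt0; rewrite subr_gt0 (le_lt_trans x1)// ltr1n.
Qed.

Lemma plateau0 x : 2 <= x -> plateau x = 0.
Proof. by move=> x2; rewrite /plateau (@flat_le0 0 (2 - x)) ?subr_le0// mul0r. Qed.

End flat_function.

Section bump.
Variables (R : realType) (n : nat).
Local Notation E := ('rV[R]_n * R)%type.

Definition box (q0 : E) (r : R) : set E :=
  [set q | forall j, `|pcoord j q - pcoord j q0| <= r].

Lemma box_compact q0 r : compact (box q0 r).
Proof.
have -> : box q0 r =
  [set v : 'rV[R]_n | forall a, `[q0.1 0 a - r, q0.1 0 a + r]%classic (v ord0 a)]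
   `*` `[q0.2 - r, q0.2 + r]%classic.
  apply/seteqP; split=> [q qr|q [q1 q2]]; first split=> [a|] /=.
  - by have := qr (Some a); rewrite /= in_itv/= ler_distl.
  - by have := qr None; rewrite /= in_itv/= ler_distl.
  move=> [a|] /=; rewrite ler_distl; last by move: q2; rewrite /= in_itv.
  by have := q1 a; rewrite /= in_itv.
apply: compact_setX; last exact: segment_compact.
apply: (@rV_compact _ _ (fun a => `[q0.1 0 a - r, q0.1 0 a + r]%classic)) => a.
exact: segment_compact.
Qed.

Definition bump (q0 : E) (r : R) (q : E) : R :=
  \prod_(j : option 'I_n)
    (plateau (r^-1 * pcoord j q - r^-1 * pcoord j q0) *
     plateau (- (r^-1) * pcoord j q + r^-1 * pcoord j q0)).

Lemma bump_smooth q0 r : smooth_on setT (bump q0 r).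
Proof.
have s1 (c b : R) (j : option 'I_n) :
    smooth_on setT (fun q : E => plateau (c * pcoord j q + b)).
  have sp := smooth_on_affine1 c b (@plateau_smooth R).
  have s : smooth_on setT
      (fun q : E => (fun x => plateau (c * x + b)) (pcoord j q + 0)).
    apply: (smooth_on_affine (l := pcoord j) openT _ _ sp) => //.
    exact: pcoord_continuous.
  by apply: (smooth_on_eq openT _ s) => q _; rewrite addr0.
by apply: (smooth_on_prod _ openT) => j _; apply: (smooth_onM openT); exact: s1.
Qed.

Lemma bump1 q0 r q : 0 < r -> box q0 r q -> bump q0 r q = 1.
Proof.
move=> r0 qr; apply: big1 => j _; have := qr j; rewrite ler_distl => /andP[h1 h2].
rewrite !plateau1 ?mulr1//.
  rewrite mulNr addrC -mulrBr ler_pdivrMl// mulr1; lra.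
by rewrite -mulrBr ler_pdivrMl// mulr1; lra.
Qed.

Lemma bump0 q0 r q : 0 < r -> ~ box q0 (2 * r) q -> bump q0 r q = 0.
Proof.
move=> r0 /existsNP[j /negP]; rewrite -ltNge => qj.
rewrite /bump (bigD1 j)//=.
suff -> : plateau (r^-1 * pcoord j q - r^-1 * pcoord j q0) *
     plateau (- (r^-1) * pcoord j q + r^-1 * pcoord j q0) = 0 by rewrite mul0r.
move: qj; rewrite ltr_normr => /orP[h|h].
  by rewrite plateau0 ?mul0r// -mulrBr ler_pdivlMl//; lra.
rewrite [X in _ * X]plateau0 ?mulr0//.
by rewrite mulNr addrC -mulrBr ler_pdivlMl//; lra.
Qed.

(** The value is 1 on a whole neighbourhood of [q0], so that multiplying by the
    bump changes no derivative at [q0]. *)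
Lemma bump_exists (O : set E) q0 : open O -> O q0 ->
  exists b : E -> R, exists K : set E,
    [/\ smooth_on setT b, compact K, K `<=` O,
        forall q, ~ K q -> b q = 0 & \forall q \near q0, b q = 1].
Proof.
move=> oO Oq0; have [r r0 rO] := (near_normE q0 O).1 (open_nbhs_nbhs (conj oO Oq0)).
have r40 : 0 < r / 4 by rewrite divr_gt0.
exists (bump q0 (r / 4)), (box q0 (2 * (r / 4))); split.
- exact: bump_smooth.
- exact: box_compact.
- move=> q qr; rewrite -(subrKC q0 q); apply: rO.
  apply: (@le_lt_trans _ _ (2 * (r / 4))); last by lra.
  apply: norm_le_pcoord; first by lra.
  by move=> j; rewrite linearB; exact: qr.
- by move=> q; exact: bump0.
apply/near_normE; exists (r / 4) => // v vr; apply: bump1 => // j.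
rewrite linearD addrC addKr; exact: (le_trans (pcoord_norm j v) (ltW vr)).
Qed.

End bump.

(** * Changes of charts *)

Section charts.
Variables (R : realType) (E : normedModType R) (X : manifold E).
Implicit Types (i j k : chart X) (p : X) (O : set X).

Lemma icoord_dom i q : (coord i @` dom i) q -> dom i (icoord i q).
Proof. by move=> [p ip <-]; rewrite coordK. Qed.

Lemma icoordK i q : (coord i @` dom i) q -> coord i (icoord i q) = q.
Proof. by move=> [p ip <-]; rewrite coordK. Qed.

Lemma chart_imageE i O q : (coord i @` (dom i `&` O)) q <->
  (coord i @` dom i) q /\ O (icoord i q).
Proof.
split=> [[p [ip Op] <-]|[[p ip <-]]]; first by rewrite coordK//; split=> //; exists p.
by rewrite coordK// => Op; exists p.
Qed.

Lemma chart_image_open i O : open O -> open (coord i @` (dom i `&` O)).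
Proof.
move=> oO; rewrite openE => q /chart_imageE[iq Oq].
have n1 := open_nbhs_nbhs (conj (codom_open i) iq).
have n2 := icoord_continuous iq (open_nbhs_nbhs (conj oO Oq)).
by apply: filterS2 n1 n2 => q' ? ?; apply/chart_imageE.
Qed.

Lemma near_chart i p (P : set X) : dom i p -> (\forall p' \near p, P p') ->
  \forall q \near coord i p,
    [/\ (coord i @` dom i) q, dom i (icoord i q) & P (icoord i q)].
Proof.
move=> ip; rewrite {1}(_ : p = icoord i (coord i p)); last by rewrite coordK.
move=> nP; have iq : (coord i @` dom i) (coord i p) by exists p.
have n1 := open_nbhs_nbhs (conj (codom_open i) iq).
apply: filterS2 n1 (icoord_continuous iq nP) => q q1 q2.
by split=> //; exact: icoord_dom.
Qed.

Lemma trans_diff i j p : dom i p -> dom j p ->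
  differentiable (coord j \o icoord i) (coord i p).
Proof.
move=> ip jp; apply: smooth_diff (transition_smooth i j) _.
by exists p.
Qed.

(** Since [to_chart], [lie_derive] and [tangent_map] are defined through the
    preferred chart at each point, this chain rule is what lets all of them be
    computed in one fixed chart. *)
Lemma diff_chart (F : normedModType R) (f : X -> F) i j p : dom i p -> dom j p ->
  differentiable (f \o icoord j) (coord j p) ->
  differentiable (f \o icoord i) (coord i p) /\
  'd (f \o icoord i) (coord i p) =
    'd (f \o icoord j) (coord j p) \o 'd (coord j \o icoord i) (coord i p) :> (E -> F).
Proof.
move=> ip jp df; have dt := trans_diff ip jp.
pose t := coord j \o icoord i.
have tE : t (coord i p) = coord j p by rewrite /t /= coordK.
have df' : differentiable (f \o icoord j) (t (coord i p)) by rewrite tE.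
have dc : differentiable ((f \o icoord j) \o t) (coord i p) by exact: differentiable_comp.
have nE : {near coord i p, (f \o icoord j) \o t =1 f \o icoord i}.
  have nj : \forall p' \near p, dom j p'.
    exact: (open_nbhs_nbhs (conj (dom_open j) jp)).
  by apply: filterS (near_chart ip nj) => q [_ _ jq]; rewrite /t /= coordK.
have [d1 d2] := near_eq_diff nE dc.
split; first exact: d1.
by rewrite d2 -tE; exact: diff_comp dt df'.
Qed.

Lemma trans_chain i j k p v : dom i p -> dom j p -> dom k p ->
  'd (coord k \o icoord j) (coord j p) ('d (coord j \o icoord i) (coord i p) v) =
  'd (coord k \o icoord i) (coord i p) v.
Proof.
move=> ip jp kp; have [_ e] := diff_chart ip jp (trans_diff jp kp).
exact: (esym (congr1 (fun h : E -> E => h v) e)).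
Qed.

Lemma trans_id i p v : dom i p -> 'd (coord i \o icoord i) (coord i p) v = v.
Proof.
move=> ip; have iq : (coord i @` dom i) (coord i p) by exists p.
have nE : {near coord i p, id =1 coord i \o icoord i}.
  apply: filterS (open_nbhs_nbhs (conj (codom_open i) iq)) => q qi.
  by rewrite /= icoordK.
have di : differentiable (@id E) (coord i p) by exact: ex_diff.
have [_ ->] := near_eq_diff nE di.
have idE : 'd (@id E) (coord i p) = id :> (E -> E) by exact: diff_val.
by rewrite idE.
Qed.

Lemma trans_eq0 i j p v : dom i p -> dom j p ->
  'd (coord j \o icoord i) (coord i p) v = 0 <-> v = 0.
Proof.
move=> ip jp; have l0 (l : {linear E -> E}) : l 0 = 0 by exact: linear0.
split=> [e|->]; last exact: l0.
rewrite -[LHS](trans_id _ ip) -(trans_chain _ ip jp ip).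
move: e; move: ('d _ _ v) => u ->; exact: l0.
Qed.

Lemma to_chartK i p v : dom i p -> of_chart i p (to_chart i p v) = v.
Proof.
move=> ip; have cp := dom_chart_at p.
by rewrite /of_chart /to_chart trans_chain// trans_id.
Qed.

Lemma of_chartK i p v : dom i p -> to_chart i p (of_chart i p v) = v.
Proof.
move=> ip; have cp := dom_chart_at p.
by rewrite /of_chart /to_chart trans_chain// trans_id.
Qed.

Fact of_chart_is_linear i p : linear (of_chart i p).
Proof. exact: linearP. Qed.

HB.instance Definition _ i p :=
  GRing.isLinear.Build R E E _ (of_chart i p) (of_chart_is_linear i p).

Fact to_chart_is_linear i p : linear (to_chart i p).
Proof. exact: linearP. Qed.

HB.instance Definition _ i p :=
  GRing.isLinear.Build R E E _ (to_chart i p) (to_chart_is_linear i p).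

Lemma to_chart_trans i j p v : dom i p -> dom j p ->
  to_chart j p v = 'd (coord j \o icoord i) (coord i p) (to_chart i p v).
Proof.
by move=> ip jp; rewrite /to_chart trans_chain//; exact: dom_chart_at.
Qed.

Lemma vcompE i (V : vfield X) p : dom i p -> vcomp i V (coord i p) = to_chart i p (V p).
Proof. by move=> ip; rewrite /vcomp coordK. Qed.

Lemma lie_derive_chart i (V : vfield X) (f : X -> R) p : dom i p ->
  differentiable (f \o icoord i) (coord i p) ->
  lie_derive V f p = 'd (f \o icoord i) (coord i p) (to_chart i p (V p)).
Proof.
move=> ip df; have [_ e] := diff_chart (dom_chart_at p) ip df.
exact: (congr1 (fun h : E -> R => h (V p)) e).
Qed.

End charts.

(** * Extension of local fields and locality of the connection data *)

Section extension.
Variables (R : realType) (n : nat).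
Local Notation E := ('rV[R]_n * R)%type.
Variable X : manifold E.
Implicit Types (i j : chart X) (p : X) (O : set X).

(** Here the Hausdorff axiom enters: the complement of a compact support is open,
    so that an extension by zero is smooth. *)
Lemma icoord_compact_closed i (K : set E) : compact K -> K `<=` coord i @` dom i ->
  closed (icoord i @` K).
Proof.
move=> cK Ki; apply: (compact_closed (@manifold_hausdorff _ _ X)).
apply: continuous_compact => //; apply: continuous_in_subspaceT => q /set_mem/Ki.
exact: icoord_continuous.
Qed.

(** The domain of [i] and the complement of the support form an open cover. *)
Lemma smooth_extension (F : normedModType R) i j O (K : set E) (f : X -> E -> F) :
  open O -> compact K -> K `<=` coord i @` dom i ->
  smooth_on (coord j @` (dom j `&` (dom i `&` O))) (fun q => f (icoord j q) q) ->
  (forall p q, ~ (icoord i @` K) p -> f p q = 0) ->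
  smooth_on (coord j @` (dom j `&` O)) (fun q => f (icoord j q) q).
Proof.
move=> oO cK Ki sf f0; have clK := icoord_compact_closed cK Ki.
have oA := chart_image_open j (openI (closed_openC clK) oO).
have s0 : smooth_on (coord j @` (dom j `&` (~` (icoord i @` K) `&` O)))
    (fun q => f (icoord j q) q).
  apply: (smooth_on_eq oA _ (@smooth_on_cst _ E F _ 0)) => q /chart_imageE[_ [nK _]].
  by rewrite f0.
apply: smooth_on_sub (smooth_on_setU sf s0) => q /chart_imageE[jq Oq].
have [iq|iq] := pselect (dom i (icoord j q)).
  by left; apply/chart_imageE.
right; apply/chart_imageE; split=> //; split=> // -[r Kr rE]; apply: iq.
by rewrite -rE; apply: icoord_dom; exact: Ki.
Qed.

Definition extend_field i (z : E -> E) : vfield X :=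
  patch (fun=> 0) (dom i) (fun p => of_chart i p (z (coord i p))).

Definition extend_fun i (f : E -> R) : X -> R :=
  patch (fun=> 0) (dom i) (f \o coord i).

Section support.
Variables (i : chart X) (O : set X) (K : set E).
Hypotheses (oO : open O) (cK : compact K) (KO : K `<=` coord i @` (dom i `&` O)).

Let Ki : K `<=` coord i @` dom i.
Proof. by move=> q /KO /chart_imageE[]. Qed.

Let off_support (F : normedModType R) (f : E -> F) p :
  (forall q, ~ K q -> f q = 0) -> dom i p -> ~ (icoord i @` K) p ->
  f (coord i p) = 0.
Proof.
move=> f0 ip nK; apply: f0 => Kp; apply: nK; exists (coord i p) => //.
by rewrite coordK.
Qed.

Let trans_smooth j :
  smooth_on (coord j @` (dom j `&` (dom i `&` O))) (coord i \o icoord j).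
Proof.
apply: smooth_on_sub (transition_smooth j i) => q /chart_imageE[jq [iq _]].
exact/chart_imageE.
Qed.

Lemma extend_fun_smooth f : smooth_on setT f -> (forall q, ~ K q -> f q = 0) ->
  smooth_fun O (extend_fun i f).
Proof.
move=> sf f0 j.
apply: (@smooth_extension R i j O K (fun p _ => extend_fun i f p) oO cK Ki).
  have oA := chart_image_open j (openI (dom_open i) oO).
  have sc := smooth_on_comp oA (fun x _ => I) (trans_smooth j) sf.
  apply: (smooth_on_eq oA _ sc) => q /chart_imageE[jq [iq _]].
  by rewrite /extend_fun /patch mem_set.
move=> p q nK; rewrite /extend_fun /patch; case: ifPn => // /set_mem ip.
exact: off_support.
Qed.

Lemma extend_field_Vect z : smooth_on setT z -> (forall q, ~ K q -> z q = 0) ->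
  Vect O (extend_field i z).
Proof.
move=> sz z0; split=> [j|p nO]; last first.
  rewrite /extend_field /patch; case: ifPn => // /set_mem ip.
  rewrite z0 ?linear0// => /KO/chart_imageE[_].
  by rewrite coordK.
apply: (@smooth_extension E i j O K
  (fun p _ => to_chart j p (extend_field i z p)) oO cK Ki); last first.
  move=> p q nK; rewrite /extend_field /patch.
  case: ifPn => [/set_mem ip|_]; last exact: linear0.
  by rewrite (@off_support E z p)// !linear0.
have oA := chart_image_open j (openI (dom_open i) oO).
apply: (smooth_on_pcoordP oA) => k.
pose t := coord i \o icoord j; pose s := coord j \o icoord i.
have oB := chart_image_open i (openI (dom_open j) oO).
have ss : smooth_on (coord i @` (dom i `&` (dom j `&` O))) s.
  apply: smooth_on_sub (transition_smooth i j) => q /chart_imageE[jq [iq _]].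
  exact/chart_imageE.
have tAB q : (coord j @` (dom j `&` (dom i `&` O))) q ->
    (coord i @` (dom i `&` (dom j `&` O))) (t q).
  move=> /chart_imageE[jq [iq Oq]]; exists (icoord j q) => //.
  by split=> //; split=> //; exact: icoord_dom.
have sl l : smooth_on (coord j @` (dom j `&` (dom i `&` O)))
    (fun q => pcoord l (z (t q)) * pcoord k ('D_(pbasis l) s (t q))).
  apply: (smooth_onM oA).
    apply: (smooth_on_comp (f := fun q => pcoord l (z q)) oA (fun x _ => I)
      (trans_smooth j)).
    by apply: smooth_on_pcoord => //; exact: openT.
  apply: (smooth_on_comp (f := fun q => pcoord k ('D_(pbasis l) s q)) oA tAB
    (trans_smooth j)).
  by apply: smooth_on_pcoord => //; exact: smooth_derive.
have sS := smooth_on_sum (index_enum _) oA (fun l (_ : true) => sl l).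
apply: (smooth_on_eq oA _ sS) => q qA; have [jq [iq _]] := (chart_imageE _ _ _).1 qA.
rewrite /extend_field /patch mem_set//.
rewrite (to_chart_trans _ iq (icoord_dom jq)) of_chartK//.
have ds : differentiable s (t q) by exact: smooth_diff ss (tAB _ qA).
rewrite (diff_pbasis _ ds) linear_sum /=; apply: eq_bigr => l _.
by rewrite linearZ.
Qed.

End support.

(** The connection acts on fields defined on all of [O], so Koszul's formula can
    be tested only on such fields; locally constant ones are enough. *)
Lemma constant_field_extension i O p (u : E) : open O -> O p -> dom i p ->
  exists2 Z : vfield X, Vect O Z & \forall q \near coord i p, vcomp i Z q = u.
Proof.
move=> oO Op ip; have oA := chart_image_open i oO.
have Ap : (coord i @` (dom i `&` O)) (coord i p) by exists p.
have [b [K [sb cK KA b0 b1]]] := bump_exists oA Ap.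
exists (extend_field i (fun q => b q *: u)).
  apply: (extend_field_Vect oO cK KA); first exact: (smooth_onZl u openT sb).
  by move=> q nK; rewrite b0// scale0r.
have n1 := open_nbhs_nbhs (conj oA Ap).
apply: filterS2 b1 n1 => q bq /chart_imageE[iq _].
have iq' := icoord_dom iq.
by rewrite /vcomp /extend_field /patch mem_set// of_chartK// icoordK// bq scale1r.
Qed.

Lemma coordinate_extension i O p k : open O -> O p -> dom i p ->
  exists2 f : X -> R, smooth_fun O f &
    \forall q \near coord i p, f (icoord i q) = pcoord k q.
Proof.
move=> oO Op ip; have oA := chart_image_open i oO.
have Ap : (coord i @` (dom i `&` O)) (coord i p) by exists p.
have [b [K [sb cK KA b0 b1]]] := bump_exists oA Ap.
exists (extend_fun i (fun q => b q * pcoord k q)).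
  apply: (extend_fun_smooth oO cK KA).
    apply: (smooth_onM openT sb); apply: smooth_on_lin; exact: pcoord_continuous.
  by move=> q nK; rewrite b0// mul0r.
have n1 := open_nbhs_nbhs (conj oA Ap).
apply: filterS2 b1 n1 => q bq /chart_imageE[iq _].
have iq' := icoord_dom iq.
by rewrite /extend_fun /patch mem_set//= icoordK// bq mul1r.
Qed.

Lemma Vect_diff i O (V : vfield X) p : Vect O V -> O p -> dom i p ->
  differentiable (vcomp i V) (coord i p).
Proof.
move=> [sV _] Op ip; apply: smooth_diff (sV i) _.
by exists p.
Qed.

(** A Lie bracket is known through its action on functions on [O]; testing it on
    extended coordinate functions recovers its components.  The extension is
    equal to the coordinate on a neighbourhood of the point, which the outer of
    the two derivatives needs. *)
Lemma lie_bracket_chart i O (U W Z : vfield X) p : open O -> O p -> dom i p ->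
  Vect O U -> Vect O W -> is_lie_bracket O U W Z ->
  to_chart i p (Z p) =
    'd (vcomp i W) (coord i p) (to_chart i p (U p)) -
    'd (vcomp i U) (coord i p) (to_chart i p (W p)).
Proof.
move=> oO Op ip VU VW UWZ; apply: eq_pcoord => k.
have [f sf fk] := coordinate_extension k oO Op ip.
have dk : differentiable (@pcoord R n k) (coord i p).
  by apply: linear_differentiable; exact: pcoord_continuous.
have df q : (\forall q' \near q, f (icoord i q') = pcoord k q') ->
    differentiable (f \o icoord i) q /\ 'd (f \o icoord i) q = pcoord k :> (E -> R).
  move=> nq; have dkq : differentiable (@pcoord R n k) q.
    by apply: linear_differentiable; exact: pcoord_continuous.
  have nq' : {near q, @pcoord R n k =1 f \o icoord i}.
    by apply: filterS nq => q' /= ->.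
  have [d1 d2] := near_eq_diff nq' dkq; split; first exact: d1.
  rewrite d2; apply: diff_lin; exact: pcoord_continuous.
have lie1 (V : vfield X) : lie_derive V f p = pcoord k (to_chart i p (V p)).
  have [d1 d2] := df _ fk.
  by rewrite (lie_derive_chart V ip d1) d2.
have lie2 (V : vfield X) : Vect O V ->
    differentiable (lie_derive V f \o icoord i) (coord i p) /\
    forall v, 'd (lie_derive V f \o icoord i) (coord i p) v =
      pcoord k ('d (vcomp i V) (coord i p) v).
  move=> VV; have dV := Vect_diff VV Op ip.
  have dkV : differentiable (fun q => pcoord k (vcomp i V q)) (coord i p).
    apply: (@differentiable_comp _ _ _ _ (vcomp i V) (pcoord k)) => //.
    by apply: linear_differentiable; exact: pcoord_continuous.
  have iq : (coord i @` dom i) (coord i p) by exists p.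
  have n1 := open_nbhs_nbhs (conj (codom_open i) iq).
  have nE : {near coord i p,
      (fun q => pcoord k (vcomp i V q)) =1 lie_derive V f \o icoord i}.
    have nn : \forall q \near coord i p,
        \forall q' \near q, f (icoord i q') = pcoord k q'.
      exact: nbhs_interior fk.
    apply: filterS2 nn n1 => q nq q1.
    have [d1 d2] := df _ nq.
    have q2 := icoord_dom q1.
    rewrite -(icoordK q1) in d1 d2.
    by rewrite /= (lie_derive_chart V q2 d1) d2.
  have [d1 d2] := near_eq_diff nE dkV; split; first exact: d1.
  by move=> v; rewrite d2 diff_pcoord.
have [dU dUE] := lie2 _ VU; have [dW dWE] := lie2 _ VW.
rewrite linearB /= -lie1 (UWZ f sf p Op).
by rewrite (lie_derive_chart U ip dW) (lie_derive_chart W ip dU) dUE dWE.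
Qed.

Lemma metric_chart i (g : tensor2 X) (V W : vfield X) p (U : vfield X) : dom i p ->
  differentiable (fun q => tcomp i g (vcomp i V q) (vcomp i W q) q) (coord i p) ->
  lie_derive U (fun q => g q (V q) (W q)) p =
    'd (fun q => tcomp i g (vcomp i V q) (vcomp i W q) q) (coord i p)
      (to_chart i p (U p)).
Proof.
move=> ip dh; have iq : (coord i @` dom i) (coord i p) by exists p.
have n1 := open_nbhs_nbhs (conj (codom_open i) iq).
have nE : {near coord i p, (fun q => tcomp i g (vcomp i V q) (vcomp i W q) q) =1
    (fun q => g q (V q) (W q)) \o icoord i}.
  apply: filterS n1 => q q1; have q2 := icoord_dom q1.
  by rewrite /tcomp /vcomp /= !to_chartK.
have [d1 d2] := near_eq_diff nE dh.
by rewrite (lie_derive_chart U ip d1) d2.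
Qed.

End extension.

(** * Adapted charts of the line bundle *)

Section bundle.
Variables (R : realType) (n : nat) (L : line_bundle R n).
Local Notation E := ('rV[R]_n * R)%type.
Implicit Types (i : chart L) (p : L).

Lemma dom_hmul i s p : dom i p -> dom i (hmul L s p).
Proof. by rewrite !dom_proj /preimage /= proj_hmul. Qed.

Lemma coord_hmulE i s p : dom i p -> coord i (hmul L s p) = squeeze s (coord i p).
Proof.
move=> ip; rewrite [LHS]surjective_pairing coord_hmul//.
by rewrite coord_proj ?proj_hmul -?coord_proj//; exact: dom_hmul.
Qed.

Lemma icoord_squeeze i s p : dom i p -> icoord i (squeeze s (coord i p)) = hmul L s p.
Proof. by move=> ip; rewrite -coord_hmulE// coordK//; exact: dom_hmul. Qed.

(** Chart images contain whole fibres; in particular they contain the segments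
    to the zero section used by [hadamard_division]. *)
Lemma chart_image_fibre i (q : E) t : (coord i @` dom i) q -> (coord i @` dom i) (q.1, t).
Proof.
move=> [p ip <-]; have ip' := ip; rewrite dom_proj in ip'.
have [p' [pp' <-]] := fibre_onto t ip'.
have ip2 : dom i p' by rewrite dom_proj /preimage /= pp'.
exists p' => //; rewrite [LHS]surjective_pairing; congr pair.
by rewrite !coord_proj// pp'.
Qed.

Lemma chart_image_squeeze i (q : E) s : (coord i @` dom i) q ->
  (coord i @` dom i) (squeeze s q).
Proof. exact: chart_image_fibre. Qed.

Lemma puncturedE i p : dom i p -> punctured p <-> (coord i p).2 != 0.
Proof.
move=> ip; split=> [pp|p0].
  apply/eqP => p0; apply: pp; exists p => //.
  rewrite -(icoord_squeeze 0 ip) -[RHS](coordK ip); congr icoord.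
  by rewrite /squeeze mul0r -p0 -surjective_pairing.
move=> [p' _ pE]; move/eqP: p0; apply; rewrite -pE.
have ip' : dom i p'.
  by move: ip; rewrite -pE !dom_proj /preimage /= proj_hmul.
by rewrite coord_hmul// mul0r.
Qed.

Lemma punctured_open : open (@punctured R n L).
Proof.
rewrite openE => p pp; pose c := chart_at p; have cp := dom_chart_at p : dom c p.
have c0 := (puncturedE cp).1 pp.
have cc : {for p, continuous (fun p' => (coord c p').2)}.
  apply: (@continuous_comp _ _ _ (coord c) snd); first exact: coord_continuous.
  exact: continuous_snd.
have n0 : \forall x \near (coord c p).2, x != 0.
  by apply: open_nbhs_nbhs; split=> //; exact: open_neq.
have n1 : \forall p' \near p, (coord c p').2 != 0 := cc _ n0.
have n2 := open_nbhs_nbhs (conj (dom_open c) cp).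
by apply: filterS (filterI n1 n2) => p' [h1 h2]; apply/(puncturedE h2).
Qed.

Definition punctured_image i : set E := [set q | (coord i @` dom i) q /\ q.2 != 0].

Lemma punctured_imageE i : punctured_image i = coord i @` (dom i `&` @punctured R n L).
Proof.
apply/seteqP; split=> q.
  move=> [qi q0]; apply/chart_imageE; split=> //.
  by apply/(puncturedE (icoord_dom qi)); rewrite icoordK.
move=> /chart_imageE[qi qp]; split=> //.
by have := (puncturedE (icoord_dom qi)).1 qp; rewrite icoordK.
Qed.

Lemma punctured_image_open i : open (punctured_image i).
Proof. rewrite punctured_imageE; exact: chart_image_open punctured_open. Qed.

(** In adapted charts the projection is [fst] followed by a change of charts of
    the base. *)
Lemma tangent_proj i p v : dom i p ->
  tangent_map (proj L) p v =
  'd (coord (chart_at (proj L p)) \o icoord (bchart i)) (coord (bchart i) (proj L p))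
    (to_chart i p v).1.
Proof.
move=> ip; pose c := chart_at (proj L p); pose b := bchart i.
have bp : dom b (proj L p) by move: ip; rewrite dom_proj.
have cp : dom c (proj L p) := dom_chart_at _.
pose t := coord c \o icoord b.
have p1 : (coord i p).1 = coord b (proj L p) by rewrite coord_proj.
have dt : differentiable t (coord i p).1 by rewrite p1; exact: trans_diff.
have dfst : differentiable (fst : E -> 'rV[R]_n) (coord i p).
  by apply: linear_differentiable; exact: continuous_fst.
have dtf : differentiable (t \o fst) (coord i p) by exact: differentiable_comp.
have iq : (coord i @` dom i) (coord i p) by exists p.
have nE : {near coord i p, t \o fst =1 (coord c \o proj L) \o icoord i}.
  apply: filterS (open_nbhs_nbhs (conj (codom_open i) iq)) => q qi.
  have qd := icoord_dom qi.
  rewrite /t /= -[in LHS](icoordK qi) coord_proj// coordK//.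
  by move: qd; rewrite dom_proj.
have [d1 d2] := near_eq_diff nE dtf.
have [_ e] := diff_chart (dom_chart_at p) ip d1.
rewrite /tangent_map -[coord c \o proj L \o _]/((coord c \o proj L) \o _) e /= d2.
rewrite (diff_comp dfst dt) /= diff_lin; last exact: continuous_fst.
by rewrite p1.
Qed.

Lemma verticalE i p v : dom i p -> vertical p v <-> (to_chart i p v).1 = 0.
Proof.
move=> ip; rewrite /vertical /= (tangent_proj v ip).
have bp : dom (bchart i) (proj L p) by move: ip; rewrite dom_proj.
exact: trans_eq0 bp (dom_chart_at (proj L p)).
Qed.

Lemma line_derive1 (F : normedModType R) (a w : F) (s : R) :
  derive1 (fun s : R => a + s *: w) s = w.
Proof.
have di : differentiable (@id F) (a + s *: w) by exact: ex_diff.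
have idE : 'd (@id F) (a + s *: w) = id :> (F -> F) by exact: diff_val.
have h := is_derive_line di.
by rewrite derive1E; have := @derive_val _ _ _ _ _ _ _ h; rewrite idE.
Qed.

Lemma eulerE p : euler p = (0, (coord (chart_at p) p).2).
Proof.
rewrite /euler; have cp := dom_chart_at p.
under eq_fun do rewrite coord_hmulE// squeeze_line.
exact: line_derive1.
Qed.

(** The orbit of [p] is a straight line in every adapted chart, and a change of
    adapted charts maps the one to the other. *)
Lemma to_chart_euler i p : dom i p -> to_chart i p (euler p) = (0, (coord i p).2).
Proof.
move=> ip; rewrite eulerE /to_chart; set c := chart_at p.
have cp : dom c p := dom_chart_at p.
set q := coord c p; set w : E := (0, q.2).
have q1 : (q.1, 0) + 1 *: w = q.
  by rewrite -squeeze_line /squeeze mul1r -surjective_pairing.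
have dt : differentiable (coord i \o icoord c) ((q.1, 0) + 1 *: w).
  by rewrite q1; exact: trans_diff.
have h := is_derive_line dt.
have <- : 'd (coord i \o icoord c) ((q.1, 0) + 1 *: w) w =
    'd (coord i \o icoord c) q w.
  by rewrite q1.
have := @derive_val _ _ _ _ _ _ _ h => <-.
rewrite -derive1E.
rewrite (_ : (fun r : R => (coord i \o icoord c) ((q.1, 0) + r *: w)) =
  (fun r : R => ((coord i p).1, 0) + r *: ((0, (coord i p).2) : E))).
  exact: line_derive1.
apply/funext => r; rewrite -!squeeze_line /= icoord_squeeze//.
by rewrite coord_hmulE.
Qed.

(** Multiplication by [s] is [squeeze s] in each adapted chart, and [squeeze s]
    is its own differential. *)
Lemma tangent_hmul i s p v : dom i p ->
  to_chart i (hmul L s p) (tangent_map (hmul L s) p v) = squeeze s (to_chart i p v).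
Proof.
move=> ip; pose c := chart_at (hmul L s p).
have ip' := dom_hmul s ip; have cp : dom c (hmul L s p) := dom_chart_at _.
pose t := coord c \o icoord i.
have dt : differentiable t (squeeze s (coord i p)).
  by rewrite -coord_hmulE//; exact: trans_diff.
have ds : differentiable (squeeze s : E -> E) (coord i p).
  by apply: linear_differentiable; exact: squeeze_continuous.
have dts : differentiable (t \o squeeze s) (coord i p).
  exact: differentiable_comp.
have iq : (coord i @` dom i) (coord i p) by exists p.
have nE : {near coord i p, t \o squeeze s =1 (coord c \o hmul L s) \o icoord i}.
  apply: filterS (open_nbhs_nbhs (conj (codom_open i) iq)) => q qi.
  have qd := icoord_dom qi.
  by rewrite /t /= -[in LHS](icoordK qi) icoord_squeeze.
have [d1 d2] := near_eq_diff nE dts.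
have [_ e] := diff_chart (dom_chart_at p) ip d1.
set u := to_chart i p v.
have e1 : tangent_map (hmul L s) p v =
    'd ((coord c \o hmul L s) \o icoord i) (coord i p) u.
  exact: (congr1 (fun h : E -> E => h v) e).
have e2 : 'd ((coord c \o hmul L s) \o icoord i) (coord i p) u =
    'd (t \o squeeze s) (coord i p) u.
  exact: (congr1 (fun h : E -> E => h u) d2).
have e3 : 'd (t \o squeeze s) (coord i p) u =
    'd t (squeeze s (coord i p)) ('d (squeeze s) (coord i p) u).
  exact: (congr1 (fun h : E -> E => h u) (diff_comp ds dt)).
have e4 : 'd (squeeze s : E -> E) (coord i p) u = squeeze s u.
  exact: (congr1 (fun h : E -> E => h u) (diff_lin _ (@squeeze_continuous R n s))).
have e5 : 'd t (squeeze s (coord i p)) (squeeze s u) =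
    of_chart i (hmul L s p) (squeeze s u).
  by rewrite /of_chart coord_hmulE.
have e45 := etrans (congr1 ('d t (squeeze s (coord i p))) e4) e5.
have e15 := etrans e1 (etrans e2 (etrans e3 e45)).
exact: (etrans (congr1 (to_chart i (hmul L s p)) e15) (of_chartK _ ip')).
Qed.

End bundle.

(** * The connection form and the metric in adapted charts *)

Section connection.
Variables (R : realType) (n : nat) (L : line_bundle R n).
Local Notation E := ('rV[R]_n * R)%type.
Implicit Types (i : chart L) (p : L).
Variables (Phi : L -> E -> E) (omega : L -> E -> R).
Hypotheses (cPhi : Rx_connection Phi) (oPhi : connection_form Phi omega).

Lemma punctured_hmul s p : s != 0 -> punctured p -> punctured (hmul L s p).
Proof.
move=> s0 pp; have cp := dom_chart_at p.
apply/(puncturedE (dom_hmul s cp)); rewrite coord_hmul// mulf_neq0//.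
exact/(puncturedE cp).
Qed.

Lemma euler_inj p a b : punctured p -> a *: euler p = b *: euler p -> a = b.
Proof.
move=> pp; rewrite eulerE => /(congr1 snd) /=; apply: mulIf.
exact/(puncturedE (dom_chart_at p)).
Qed.

Lemma omega_linear p : punctured p -> linear (omega p).
Proof.
move=> pp k u v; apply: (euler_inj pp); rewrite -oPhi//.
have [[Phil _] _ _ _] := cPhi.
by rewrite (Phil p pp) !oPhi// scalerDl scalerA.
Qed.

Lemma omega_euler p : punctured p -> omega p (euler p) = 1.
Proof.
move=> pp; apply: (euler_inj pp); rewrite -oPhi// scale1r.
have [_ PhiPhi rPhi _] := cPhi; have cp := dom_chart_at p.
have : vertical p (euler p) by apply/(verticalE _ cp); rewrite to_chart_euler.
by rewrite -rPhi// => -[v _ <-]; exact: PhiPhi.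
Qed.

(** Invariance of the connection form: [Phi] and the Euler field commute with
    the multiplications, hence so does their quotient. *)
Lemma omega_hmul s p v : s != 0 -> punctured p ->
  omega (hmul L s p) (tangent_map (hmul L s) p v) = omega p v.
Proof.
move=> s0 pp; have [_ _ _ ePhi] := cPhi; have cp := dom_chart_at p.
have pp' := punctured_hmul s0 pp.
have t0 := (puncturedE cp).1 pp.
have := congr1 (to_chart (chart_at p) (hmul L s p)) (ePhi s s0 p pp v).
rewrite tangent_hmul// !oPhi// !linearZ /= !to_chart_euler//; last exact: dom_hmul.
move=> /(congr1 snd) /=; rewrite coord_hmul// /GRing.scale /= => e.
apply/esym/(mulIf (mulf_neq0 s0 t0)).
by rewrite -e mulrCA.
Qed.

(** The analogue of [tcomp] for the one-form [omega]. *)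
Definition form_comp i (q : E) (u : E) : R :=
  omega (icoord i q) (of_chart i (icoord i q) u).

Section chart.
Variable i : chart L.

Lemma punctured_image_dom q : punctured_image i q ->
  dom i (icoord i q) /\ punctured (icoord i q).
Proof.
move=> [qi q0]; have qd := icoord_dom qi; split=> //.
by apply/(puncturedE qd); rewrite icoordK.
Qed.

Lemma form_comp_linear q : punctured_image i q -> linear (form_comp i q).
Proof.
move=> /punctured_image_dom[qd qp] k u v.
by rewrite /form_comp linearP; exact: omega_linear.
Qed.

Lemma form_comp_fibre q : punctured_image i q -> form_comp i q (0, q.2) = 1.
Proof.
move=> qP; have [qd qp] := punctured_image_dom qP; have [qi _] := qP.
rewrite -(omega_euler qp) /form_comp; congr omega.
by rewrite -[RHS](to_chartK _ qd) to_chart_euler// icoordK.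
Qed.

Lemma form_comp_squeeze s q u : s != 0 -> punctured_image i q ->
  form_comp i (squeeze s q) (squeeze s u) = form_comp i q u.
Proof.
move=> s0 qP; have [qd qp] := punctured_image_dom qP; have [qi _] := qP.
rewrite /form_comp -(omega_hmul _ s0 qp).
have -> : icoord i (squeeze s q) = hmul L s (icoord i q).
  by rewrite -(icoord_squeeze s qd) icoordK.
congr omega.
have e := tangent_hmul s (of_chart i (icoord i q) u) qd.
rewrite (of_chartK _ qd) in e.
exact: etrans (congr1 (of_chart i _) (esym e)) (to_chartK _ (dom_hmul s qd)).
Qed.

(** By invariance, the coefficient of the connection form along [dx^a] can be
    read off on the slice [t = 1], whatever the value of [t]; this is why it has
    a smooth extension to the zero section. *)
Definition conn_coef (a : 'I_n) (q : E) : R := form_comp i (q.1, 1) (pbasis (Some a)).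

Lemma form_comp_horizontal a q : punctured_image i q ->
  form_comp i q (pbasis (Some a)) = conn_coef a q.
Proof.
move=> qP; have [_ q0] := qP; have q0' : q.2^-1 != 0 by rewrite invr_eq0.
rewrite /conn_coef -(form_comp_squeeze _ q0' qP); congr form_comp.
  by rewrite /squeeze mulVf.
by rewrite /squeeze /= mulr0.
Qed.

(** The Euler field t d/dt has value 1, and the other coefficients do not depend
    on t: this is the local formula dt/t + A_a dx^a. *)
Lemma form_compE q u : punctured_image i q ->
  form_comp i q u = u.2 / q.2 + \sum_a u.1 0 a * conn_coef a q.
Proof.
move=> qP; have [_ q0] := qP.
have e1 : form_comp i q u = \sum_j pcoord j u * form_comp i q (pbasis j).
  exact: linear_pbasis (form_comp_linear qP) u.
have e2 : form_comp i q (pbasis None) = q.2^-1.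
  have := form_comp_fibre qP.
  have -> : ((0, q.2) : E) = q.2 *: pbasis None.
    by rewrite /pbasis -[RHS]/(_ *: 0, _ * 1) scaler0 mulr1.
  rewrite (linearE_scale (form_comp_linear qP)) => e.
  by apply: (mulfI q0); rewrite mulfV.
have e3 : \sum_a u.1 0 a * form_comp i q (pbasis (Some a)) =
    \sum_a u.1 0 a * conn_coef a q.
  by apply: eq_bigr => a _; rewrite -(form_comp_horizontal a qP).
rewrite -e2 -e3 [LHS]e1 big_option; exact: addrC.
Qed.

Lemma smooth_unit_slice (F : E -> R) : smooth_on (punctured_image i) F ->
  smooth_on (coord i @` dom i) (fun q => F (q.1, 1)).
Proof.
move=> sF; have oO := codom_open i.
have sq (q : E) : squeeze 0 q + (0, 1) = (q.1, 1).
  by rewrite -[LHS]/(q.1 + 0, 0 * q.2 + 1) addr0 mul0r add0r.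
have lO q : (coord i @` dom i) q -> punctured_image i (squeeze 0 q + (0, 1)).
  by rewrite sq => qi; split; [exact: chart_image_fibre|rewrite oner_neq0].
(* The slice t = 1 is the image of the affine map [squeeze 0 q + (0, 1)]. *)
have sA := smooth_on_affine (l := squeeze 0) (b := (0, 1)) oO
  (@squeeze_continuous R n 0) lO sF.
by apply: (smooth_on_eq oO _ sA) => q _; rewrite sq.
Qed.

Lemma conn_coef_smooth a : smooth_on (coord i @` dom i) (conn_coef a).
Proof.
have [[_ sPhi] _ _ _] := cPhi.
have := sPhi i (pbasis (Some a)); rewrite -punctured_imageE => sF.
have oO := codom_open i.
have sF1 := smooth_on_pcoord None (@punctured_image_open _ _ _ i) sF.
have sF2 := smooth_unit_slice sF1.
apply: (smooth_on_eq oO _ sF2) => q qi.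
have qP : punctured_image i (q.1, 1).
  by split; [exact: chart_image_fibre|rewrite oner_neq0].
have [qd qp] := punctured_image_dom qP; have [qi' _] := qP.
rewrite oPhi// linearZ /= to_chart_euler// icoordK// /GRing.scale /= mulr1.
by [].
Qed.

End chart.
End connection.

Section metric.
Variables (R : realType) (n : nat) (L : line_bundle R n) (g : tensor2 L).
Local Notation E := ('rV[R]_n * R)%type.
Hypothesis cg : carrollian g.
Variable i : chart L.

Lemma tcomp_linear u q : punctured_image i q -> linear (tcomp i g u ^~ q).
Proof.
move=> /punctured_image_dom[qd qp] k v w; have [[gl _ _] _] := cg.
by rewrite /tcomp linearP; exact: gl.
Qed.

Lemma tcomp_sym u v q : punctured_image i q -> tcomp i g u v q = tcomp i g v u q.
Proof. by move=> /punctured_image_dom[qd qp]; have [[_ gs _] _] := cg; exact: gs. Qed.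

Lemma tcomp_vertical v q : punctured_image i q -> tcomp i g v (pbasis None) q = 0.
Proof.
move=> qP; have [qd qp] := punctured_image_dom qP; rewrite tcomp_sym//.
have [_ /(_ _ qp) gk] := cg.
have vN : vertical (icoord i q) (of_chart i (icoord i q) (pbasis None)).
  by apply/(verticalE _ qd); rewrite of_chartK.
by rewrite -gk in vN; exact: vN.
Qed.

(** The fibre direction is in the kernel of [g], so only the g_ab remain. *)
Lemma tcomp_gab q u v : punctured_image i q ->
  tcomp i g u v q = \sum_a \sum_b gab i g q a b * (u.1 0 a * v.1 0 b).
Proof.
move=> qP.
have half w z : tcomp i g w z q = \sum_b z.1 0 b * tcomp i g w (pbasis (Some b)) q.
  have := linear_pbasis (tcomp_linear w qP) z; rewrite big_option tcomp_vertical//.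
  by rewrite scaler0 addr0.
rewrite half exchange_big /=; apply: eq_bigr => b _.
rewrite tcomp_sym// half mulr_sumr; apply: eq_bigr => a _.
rewrite mxE -/(pbasis (Some a)) -/(pbasis (Some b)) tcomp_sym//.
by rewrite mulrCA mulrA mulrC.
Qed.

(** A vector in the kernel of the matrix (g_ab), given the fibre component 0, is
    in the kernel of [g], hence vertical, hence zero. *)
Lemma gab_unit q : punctured_image i q -> gab i g q \in unitmx.
Proof.
move=> qP; have [qd qp] := punctured_image_dom qP.
rewrite unitmxE unitfE; apply/det0P => -[v v0 vG]; move/eqP: v0; apply.
have [_ /(_ _ qp) gk] := cg.
have : vertical (icoord i q) (of_chart i (icoord i q) (v, 0)).
  rewrite -gk /= => w; rewrite -(to_chartK w qd).
  rewrite -[LHS]/(tcomp i g (v, 0) (to_chart i (icoord i q) w) q) tcomp_gab//=.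
  rewrite exchange_big /= big1// => b _.
  have /rowP/(_ b) := vG; rewrite !mxE => vGb.
  under eq_bigr do rewrite mulrA [gab i g q _ b * _]mulrC.
  by rewrite -mulr_suml vGb mul0r.
by move=> /(verticalE _ qd); rewrite of_chartK.
Qed.

End metric.

(** * Koszul's formula in a chart *)

(** The linear combination of the three metric conditions and the three torsion
    conditions that isolates the covariant derivative; [s10] is its pairing with
    the test vector. *)
Fact koszul_algebra (R : realType)
    (s s0 s1 s2 s3 s4 s5 s6 s7 s8 s9 s10 s11 : R) :
  s1 + s11 + 0 = s10 + s9 -> s0 + s8 + 0 = s7 + s6 -> s + s5 + s4 = s3 + s2 ->
  s10 - s7 = s11 - s8 -> s9 - s3 = 0 - s5 -> s6 - s2 = 0 - s4 ->
  2 * (s10 - s11) = s1 + s0 - s.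
Proof. lra. Qed.

Section koszul.
Variables (R : realType) (n : nat).
Local Notation E := ('rV[R]_n * R)%type.

Section derivatives.
Variables (D : normedModType R) (O : set D) (q w : D).
Hypothesis Oq : O q.

Lemma smooth_deriveM (f g : D -> R) : smooth_on O f -> smooth_on O g ->
  'D_w (fun x => f x * g x) q = 'D_w f q * g q + f q * 'D_w g q.
Proof.
move=> sf sg; rewrite -[LHS]/('D_w (f * g) q) deriveM.
- by rewrite addrC /GRing.scale /= [g q * _]mulrC.
- by apply: diff_derivable; exact: smooth_diff sf Oq.
- by apply: diff_derivable; exact: smooth_diff sg Oq.
Qed.

Lemma smooth_deriveD (f g : D -> R) : smooth_on O f -> smooth_on O g ->
  'D_w (fun x => f x + g x) q = 'D_w f q + 'D_w g q.
Proof.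
move=> sf sg; apply: deriveD.
- by apply: diff_derivable; exact: smooth_diff sf Oq.
- by apply: diff_derivable; exact: smooth_diff sg Oq.
Qed.

Lemma smooth_derive_sum (I : Type) (r : seq I) (f : I -> D -> R) : open O ->
  (forall i, smooth_on O (f i)) ->
  'D_w (fun x => \sum_(i <- r) f i x) q = \sum_(i <- r) 'D_w (f i) q.
Proof.
move=> oO sf; elim: r => [|i r IH].
  rewrite big_nil (_ : (fun x => _) = cst 0); first exact: derive_cst.
  by apply/funext => x; rewrite big_nil.
rewrite big_cons -IH -smooth_deriveD//; last by apply: smooth_on_sum => // j _; exact: sf.
by congr ('D_w _ q); apply/funext => x; rewrite big_cons.
Qed.

End derivatives.

(** The Leibniz rule for a field of bilinear forms, in which ['D_w (h u v)] at
    frozen vectors [u] and [v] plays the role of the derivative of the tensor. *)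
Lemma bilinear_field_derive (O : set E) (h : E -> E -> E -> R) (y z : E -> E) q w :
  open O -> O q ->
  (forall q u, O q -> linear (fun v => h u v q)) ->
  (forall q u, O q -> linear (fun v => h v u q)) ->
  (forall u v, smooth_on O (h u v)) -> smooth_on O y -> smooth_on O z ->
  smooth_on O (fun q => h (y q) (z q) q) /\
  'D_w (fun q => h (y q) (z q) q) q =
  'D_w (h (y q) (z q)) q + h ('D_w y q) (z q) q + h (y q) ('D_w z q) q.
Proof.
move=> oO Oq l2 l1 sh sy sz.
pose H (j k : option 'I_n) := h (pbasis j) (pbasis k).
have hE q' u v : O q' -> h u v q' = \sum_j pcoord j u * \sum_k pcoord k v * H j k q'.
  move=> Oq'; rewrite (linear_pbasis (l1 q' v Oq') u); apply: eq_bigr => j _.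
  by rewrite (linear_pbasis (l2 q' (pbasis j) Oq') v).
have syj j := smooth_on_pcoord j oO sy; have szj j := smooth_on_pcoord j oO sz.
have sk j k : smooth_on O (fun q => pcoord k (z q) * H j k q) :=
  smooth_onM oO (szj k) (sh _ _).
have sks j : smooth_on O (fun q => \sum_k pcoord k (z q) * H j k q).
  by apply: smooth_on_sum => // k _; exact: sk.
have sj j : smooth_on O
    (fun q => pcoord j (y q) * \sum_k pcoord k (z q) * H j k q).
  exact: (smooth_onM oO (syj j) (sks j)).
have sS : smooth_on O
    (fun q => \sum_j pcoord j (y q) * \sum_k pcoord k (z q) * H j k q).
  by apply: smooth_on_sum => // j _; exact: sj.
have hyz x : O x ->
    \sum_j pcoord j (y x) * \sum_k pcoord k (z x) * H j k x = h (y x) (z x) x.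
  by move=> Ox; rewrite -hE.
split; first exact: smooth_on_eq oO hyz sS.
have dy := smooth_diff sy Oq; have dz := smooth_diff sz Oq.
rewrite (open_eq_derive w oO Oq hyz (smooth_diff sS Oq)).
rewrite (smooth_derive_sum w Oq _ oO sj).
have sc (c : R) : smooth_on O (fun _ : E => c) by exact: smooth_on_cst.
have dH u v : 'D_w (h u v) q =
    \sum_j pcoord j u * \sum_k pcoord k v * 'D_w (H j k) q.
  have s1 j k : smooth_on O (fun q => pcoord k v * H j k q) :=
    smooth_onM oO (sc _) (sh _ _).
  have s2 j : smooth_on O (fun q => \sum_k pcoord k v * H j k q).
    by apply: smooth_on_sum => // k _; exact: s1.
  have s3 j : smooth_on O (fun q => pcoord j u * \sum_k pcoord k v * H j k q).
    exact: (smooth_onM oO (sc _) (s2 j)).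
  have s4 : smooth_on O
      (fun q => \sum_j pcoord j u * \sum_k pcoord k v * H j k q).
    by apply: smooth_on_sum => // j _; exact: s3.
  have hE' x Ox := esym (hE x u v Ox).
  rewrite (open_eq_derive w oO Oq hE' (smooth_diff s4 Oq)).
  rewrite (smooth_derive_sum w Oq _ oO s3).
  apply: eq_bigr => j _; rewrite (smooth_deriveM w Oq (sc _) (s2 j)).
  rewrite derive_cst mul0r add0r (smooth_derive_sum w Oq _ oO (s1 j)).
  congr (_ * _); apply: eq_bigr => k _; rewrite (smooth_deriveM w Oq (sc _) (sh _ _)).
  by rewrite derive_cst mul0r add0r.
rewrite dH (hE q ('D_w y q) (z q) Oq) (hE q (y q) ('D_w z q) Oq).
rewrite -!big_split /=.
apply: eq_bigr => j _.
rewrite (smooth_deriveM w Oq (syj j) (sks j)) derive_pcoord//.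
rewrite (smooth_derive_sum w Oq _ oO (sk j)).
rewrite [RHS]addrAC [RHS]addrC; congr (_ + _).
rewrite -mulrDr -big_split /=; congr (_ * _); apply: eq_bigr => k _.
by rewrite (smooth_deriveM w Oq (szj k) (sh _ _)) derive_pcoord// addrC.
Qed.

Variable X : manifold E.

(** Koszul's formula with a locally constant test field of value [u].  Its
    brackets with the other fields are plain derivatives, and subtracting
    ['D_x (vcomp i W)] leaves only derivatives of the metric: this is the
    formula for the Christoffel symbols. *)
Lemma koszul_chart (O : set X) (g : tensor2 X)
    (nabla : vfield X -> vfield X -> vfield X)
    (i : chart X) (p : X) (V W : vfield X) (u : E) :
  open O -> O p -> dom i p -> symmetric_tensor O g -> levi_civita O g nabla ->
  Vect O V -> Vect O W ->
  let q := coord i p in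
  let x := to_chart i p (V p) in
  let y := to_chart i p (W p) in
  2 * tcomp i g (to_chart i p (nabla V W p) - 'D_x (vcomp i W) q) u q =
  'D_x (tcomp i g y u) q + 'D_y (tcomp i g x u) q - 'D_u (tcomp i g x y) q.
Proof.
move=> oO Op ip [gl gs gsm] [[cV _] tf mc] VV VW q x y.
have oP := chart_image_open i oO.
have Pq : (coord i @` (dom i `&` O)) q by exists p.
have [Z VZ nZ] := constant_field_extension u oO Op ip.
have zq : vcomp i Z q = u := nbhs_singleton nZ.
have dZ (w : E) : 'D_w (vcomp i Z) q = 0.
  have [d1 d2] := near_eq_diff (f := cst u) (g := vcomp i Z)
    (filterS (fun x e => esym e) nZ) (differentiable_cst u q).
  by rewrite (deriveE _ d1) d2 diff_cst.
have l2 q' a : (coord i @` (dom i `&` O)) q' -> linear (fun v => tcomp i g a v q').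
  move=> /chart_imageE[q1 q2] k v w.
  by rewrite /tcomp linearP; exact: gl.
have sym q' a b : (coord i @` (dom i `&` O)) q' -> tcomp i g a b q' = tcomp i g b a q'.
  by move=> /chart_imageE[q1 q2]; exact: gs.
have l1 q' a : (coord i @` (dom i `&` O)) q' -> linear (fun v => tcomp i g v a q').
  by move=> Pq' k v w; rewrite !(sym _ _ a)//; exact: l2.
have vq (U : vfield X) : to_chart i p (U p) = vcomp i U q by rewrite /q vcompE.
pose B a b := tcomp i g a b q.
have metric (U V' W' : vfield X) : Vect O U -> Vect O V' -> Vect O W' ->
    'D_(vcomp i U q) (tcomp i g (vcomp i V' q) (vcomp i W' q)) q +
      B ('D_(vcomp i U q) (vcomp i V') q) (vcomp i W' q) +
      B (vcomp i V' q) ('D_(vcomp i U q) (vcomp i W') q) =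
    B (vcomp i (nabla U V') q) (vcomp i W' q) +
      B (vcomp i V' q) (vcomp i (nabla U W') q).
  move=> VU VV' VW'.
  have [s1 <-] := bilinear_field_derive (vcomp i U q) oP Pq l2 l1 (gsm i)
    (VV'.1 i) (VW'.1 i).
  have d1 := smooth_diff s1 Pq.
  have := mc U V' W' VU VV' VW' p Op.
  rewrite (metric_chart _ ip d1) (deriveE _ d1) vq => ->.
  by rewrite /B /tcomp -!vq /q coordK// !to_chartK.
have torsion (U W' : vfield X) : Vect O U -> Vect O W' ->
    vcomp i (nabla U W') q - vcomp i (nabla W' U) q =
    'D_(vcomp i U q) (vcomp i W') q - 'D_(vcomp i W' q) (vcomp i U) q.
  move=> VU VW'; have := lie_bracket_chart oO Op ip VU VW' (tf U W' VU VW').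
  have dU := Vect_diff VU Op ip; have dW' := Vect_diff VW' Op ip.
  by rewrite linearB /= !vq (deriveE _ dU) (deriveE _ dW').
have Bl a b c : B (a - b) c = B a c - B b c := linearE_sub (l1 q c Pq) a b.
have Br c a b : B c (a - b) = B c a - B c b := linearE_sub (l2 q c Pq) a b.
have Bs a b : B a b = B b a by exact: sym.
have B0 c : B c 0 = 0 := linearE0 (l2 q c Pq).
have m1 := metric V W Z VV VW VZ; have m2 := metric W V Z VW VV VZ.
have m3 := metric Z V W VZ VV VW.
have t1 := congr1 (fun v => B v u) (torsion V W VV VW).
have t2 := congr1 (B (vcomp i W q)) (torsion V Z VV VZ).
have t3 := congr1 (B (vcomp i V q)) (torsion W Z VW VZ).
rewrite !dZ !zq ?Bl ?Br ?B0 in m1 m2 m3 t1 t2 t3.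
rewrite (Bs (vcomp i (nabla Z V) q)) (Bs ('D_u (vcomp i V) q)) in m3.
rewrite /x /y !vq -[tcomp i g _ u q]/(B _ u) Bl.
move: m1 m2 m3 t1 t2 t3.
repeat match goal with |- context [B ?a ?b] => generalize (B a b) end.
repeat match goal with |- context ['D_?v ?f ?a] => generalize ('D_v f a) end.
exact: koszul_algebra.
Qed.

End koszul.

(** * The metric g + omega^2 in an adapted chart *)

Section matrices.
Variables (R : realType) (D : normedModType R) (O : set D).
Hypothesis oO : open O.

Lemma smooth_on_det m (M : D -> 'M[R]_m) :
  (forall a b, smooth_on O (fun q => M q a b)) -> smooth_on O (fun q => \det (M q)).
Proof.
move=> sM; apply: (smooth_on_sum _ oO) => s _.
apply: (smooth_onM oO); first exact: smooth_on_cst.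
by apply: (smooth_on_prod _ oO) => a _; exact: sM.
Qed.

Lemma smooth_on_invmx m (M : D -> 'M[R]_m) :
  (forall a b, smooth_on O (fun q => M q a b)) ->
  (forall q, O q -> M q \in unitmx) ->
  forall a b, smooth_on O (fun q => invmx (M q) a b).
Proof.
move=> sM uM a b.
have sdet := smooth_on_det sM.
have det0 q : O q -> \det (M q) != 0.
  by move=> /uM; rewrite unitmxE unitfE.
have scof : smooth_on O (fun q => cofactor (M q) b a).
  apply: (smooth_onM oO); first exact: smooth_on_cst.
  apply: smooth_on_det => c d.
  apply: (smooth_on_eq oO _ (sM (lift b c) (lift a d))) => q _.
  by rewrite !mxE.
have sinv := smooth_onM oO (smooth_onV oO det0 sdet) scof.
apply: (smooth_on_eq oO _ sinv) => q Oq.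
by rewrite /invmx uM// !mxE.
Qed.

End matrices.

Section local_formula.
Variables (R : realType) (n : nat).
Local Notation E := ('rV[R]_n * R)%type.
Variables (O : set E) (A : 'I_n -> E -> R) (G : E -> 'M[R]_n).
Hypothesis oO : open O.
Hypothesis sA : forall a, smooth_on O (A a).
Hypothesis sG : forall a b, smooth_on O (fun q => G q a b).

Definition conn_form (u q : E) : R := u.2 / q.2 + \sum_a u.1 0 a * A a q.

Definition plus_form (u v q : E) : R :=
  \sum_a \sum_b G q a b * (u.1 0 a * v.1 0 b) + conn_form u q * conn_form v q.

Definition dG (w u v q : E) : R :=
  \sum_a \sum_b 'D_w (fun q => G q a b) q * (u.1 0 a * v.1 0 b).

(** The exterior derivative of the connection form, to which dt/t does not
    contribute. *)
Definition dA (u v q : E) : R :=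
  \sum_a (v.1 0 a * 'D_u (A a) q - u.1 0 a * 'D_v (A a) q).

Lemma field_deriveE (F : normedModType R) (f : E -> F) v q : smooth_on O f -> O q ->
  'D_v f q = \sum_j pcoord j v *: 'D_(pbasis j) f q.
Proof.
move=> sf Oq; have df := smooth_diff sf Oq.
by rewrite (deriveE _ df); exact: diff_pbasis.
Qed.

Lemma smooth_field_derive (f : E -> R) (v : E -> E) :
  smooth_on O f -> smooth_on O v -> smooth_on O (fun q => 'D_(v q) f q).
Proof.
move=> sf sv.
have sj j : smooth_on O (fun q => pcoord j (v q) * 'D_(pbasis j) f q) :=
  smooth_onM oO (smooth_on_pcoord j oO sv) (smooth_derive (pbasis j) sf).
have sS := smooth_on_sum (index_enum _) oO (fun j (_ : true) => sj j).
apply: (smooth_on_eq oO _ sS) => q Oq.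
exact/esym/field_deriveE.
Qed.

Lemma smooth_field_derive_vec (f v : E -> E) :
  smooth_on O f -> smooth_on O v -> smooth_on O (fun q => 'D_(v q) f q).
Proof.
move=> sf sv; apply: (smooth_on_pcoordP oO) => j.
have s1 := smooth_field_derive (smooth_on_pcoord j oO sf) sv.
apply: (smooth_on_eq oO _ s1) => q Oq.
exact/derive_pcoord/(smooth_diff sf Oq).
Qed.

Lemma smooth_on_row (v : E -> E) (a : 'I_n) :
  smooth_on O v -> smooth_on O (fun q => (v q).1 0 a).
Proof. exact: (@smooth_on_pcoord R n E O v (Some a) oO). Qed.

Lemma dG_smooth (w u v : E -> E) : smooth_on O w -> smooth_on O u -> smooth_on O v ->
  smooth_on O (fun q => dG (w q) (u q) (v q) q).
Proof.
move=> sw su sv.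
apply: (smooth_on_sum _ oO) => a _; apply: (smooth_on_sum _ oO) => b _.
apply: (smooth_onM oO (smooth_field_derive (sG a b) sw)).
exact: (smooth_onM oO (smooth_on_row a su) (smooth_on_row b sv)).
Qed.

Lemma dA_smooth (u v : E -> E) : smooth_on O u -> smooth_on O v ->
  smooth_on O (fun q => dA (u q) (v q) q).
Proof.
move=> su sv; apply: (smooth_on_sum _ oO) => a _; apply: (smooth_onB oO).
  exact: (smooth_onM oO (smooth_on_row a sv) (smooth_field_derive (sA a) su)).
exact: (smooth_onM oO (smooth_on_row a su) (smooth_field_derive (sA a) sv)).
Qed.

Let U : set E := O `&` [set q | q.2 != 0].

Let oU : open U.
Proof.
apply: openI => //.
exact: (open_comp (fun q _ => @continuous_snd R n q) (@open_neq R 0)).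
Qed.

Lemma snd_smooth (O' : set E) : smooth_on O' (snd : E -> R).
Proof. exact: (@smooth_on_lin R E R O' (pcoord None) (@pcoord_continuous R n None)). Qed.

Let UO : U `<=` O. Proof. by move=> q []. Qed.

Lemma conn_form_smooth u : smooth_on U (conn_form u).
Proof.
apply: (smooth_onD oU).
  apply: (smooth_onM oU); first exact: smooth_on_cst.
  by apply: (smooth_onV oU) => [q []//|]; exact: snd_smooth.
apply: (smooth_on_sum _ oU) => a _.
apply: (smooth_onM oU); first exact: smooth_on_cst.
exact: smooth_on_sub UO (sA a).
Qed.

Lemma plus_form_smooth u v : smooth_on U (plus_form u v).
Proof.
apply: (smooth_onD oU); last first.
  exact: (smooth_onM oU (conn_form_smooth u) (conn_form_smooth v)).
apply: (smooth_on_sum _ oU) => a _; apply: (smooth_on_sum _ oU) => b _.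
apply: (smooth_onM oU); last exact: smooth_on_cst.
exact: smooth_on_sub UO (sG a b).
Qed.

Lemma conn_form_derive w u q : U q ->
  'D_w (conn_form u) q = - (u.2 * w.2 / q.2 ^+ 2) + \sum_a u.1 0 a * 'D_w (A a) q.
Proof.
move=> Uq; have [Oq q0] := Uq.
have sc (c : R) : smooth_on U (fun _ : E => c) by exact: smooth_on_cst.
have sV : smooth_on U (fun q : E => q.2^-1).
  by apply: (smooth_onV oU) => [q' []//|]; exact: snd_smooth.
have sa a : smooth_on U (A a) := smooth_on_sub UO (sA a).
have sua a : smooth_on U (fun q => u.1 0 a * A a q) :=
  smooth_onM oU (sc _) (sa a).
rewrite (smooth_deriveD w Uq (smooth_onM oU (sc u.2) sV)); last first.
  by apply: (smooth_on_sum _ oU) => a _; exact: sua.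
congr (_ + _).
  rewrite (smooth_deriveM w Uq (sc u.2) sV) derive_cst mul0r add0r.
  have d2 : derivable (snd : E -> R) q w.
    by apply: diff_derivable; exact: smooth_diff (@snd_smooth U) Uq.
  rewrite deriveV//.
  have -> : 'D_w (snd : E -> R) q = w.2.
    rewrite deriveE; last exact: smooth_diff (@snd_smooth U) Uq.
    by rewrite diff_lin//; exact: continuous_snd.
  by rewrite /GRing.scale /= mulNr mulrN mulrA mulrAC.
rewrite (smooth_derive_sum w Uq _ oU sua); apply: eq_bigr => a _.
by rewrite (smooth_deriveM w Uq (sc _) (sa a)) derive_cst mul0r add0r.
Qed.

Lemma plus_form_derive w u v q : U q ->
  'D_w (plus_form u v) q = dG w u v q +
    ('D_w (conn_form u) q * conn_form v q + conn_form u q * 'D_w (conn_form v) q).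
Proof.
move=> Uq; have sc (c : R) : smooth_on U (fun _ : E => c) by exact: smooth_on_cst.
have sab a b : smooth_on U (fun q => G q a b) := smooth_on_sub UO (sG a b).
have s1 a b : smooth_on U (fun q => G q a b * (u.1 0 a * v.1 0 b)) :=
  smooth_onM oU (sab a b) (sc _).
have s2 a : smooth_on U (fun q => \sum_b G q a b * (u.1 0 a * v.1 0 b)).
  by apply: (smooth_on_sum _ oU) => b _; exact: s1.
have sW := smooth_onM oU (conn_form_smooth u) (conn_form_smooth v).
rewrite (smooth_deriveD w Uq _ sW); last first.
  by apply: (smooth_on_sum _ oU) => a _; exact: s2.
rewrite (smooth_deriveM w Uq (conn_form_smooth u) (conn_form_smooth v)).
congr (_ + _); rewrite (smooth_derive_sum w Uq _ oU s2); apply: eq_bigr => a _.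
rewrite (smooth_derive_sum w Uq _ oU (s1 a)); apply: eq_bigr => b _.
by rewrite (smooth_deriveM w Uq (sab a b) (sc _)) derive_cst mulr0 addr0.
Qed.

(** The derivatives of the connection form have poles in t.  They cancel in the
    antisymmetric combinations [dA], because dt/t is closed; the symmetric
    combination survives only against the component of [u] along the Euler
    field. *)
Lemma koszul_plus_form q (x y u : E) : U q ->
  'D_x (plus_form y u) q + 'D_y (plus_form x u) q - 'D_u (plus_form x y) q =
  dG x y u q + dG y x u q - dG u x y q +
  conn_form u q * ('D_x (conn_form y) q + 'D_y (conn_form x) q) +
  conn_form y q * dA x u q + conn_form x q * dA y u q.
Proof.
move=> Uq; rewrite !plus_form_derive//.
have dAE v : dA v u q = 'D_v (conn_form u) q - 'D_u (conn_form v) q.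
  rewrite !conn_form_derive// /dA sumrB [v.2 * _]mulrC; ring.
by rewrite !dAE; ring.
Qed.

End local_formula.

(** * Covariant derivatives extend over the zero section *)

Section christoffel.
Variables (R : realType) (n : nat).
Local Notation E := ('rV[R]_n * R)%type.
Variables (O : set E) (A : 'I_n -> E -> R) (G : E -> 'M[R]_n).
Hypothesis oO : open O.
Hypothesis satO : forall (q : E) s, O q -> O (squeeze s q).
Hypothesis sA : forall a, smooth_on O (A a).
Hypothesis sG : forall a b, smooth_on O (fun q => G q a b).
Hypothesis uG : forall q, O q -> G q \in unitmx.

(** Away from the zero section, the horizontal lifts of the coordinate fields and
    the Euler field [fibre_field] form a frame in which g + omega^2 is the block
    matrix of (g_ab) and 1. *)
Definition horizontal_lift (b : 'I_n) (q : E) : E := (delta_mx 0 b, - (q.2 * A b q)).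
Definition fibre_field (q : E) : E := (0, q.2).

Lemma sum_delta (b : 'I_n) (F : 'I_n -> R) :
  \sum_a (delta_mx 0 b : 'rV[R]_n) 0 a * F a = F b.
Proof.
rewrite (bigD1 b)//= mxE !eqxx mul1r big1 ?addr0// => a ab.
by rewrite mxE (negbTE ab) andbF mul0r.
Qed.

Lemma conn_form_lift b q : q.2 != 0 -> conn_form A (horizontal_lift b q) q = 0.
Proof.
move=> q0; rewrite /conn_form /horizontal_lift /= sum_delta.
by rewrite mulNr mulrAC divff// mul1r addNr.
Qed.

Lemma conn_form_fibre q : q.2 != 0 -> conn_form A (fibre_field q) q = 1.
Proof.
move=> q0; rewrite /conn_form /fibre_field /= divff// big1 ?addr0// => a _.
by rewrite mxE mul0r.
Qed.

Lemma horizontal_lift_smooth b : smooth_on O (horizontal_lift b).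
Proof.
apply: (smooth_on_pcoordP oO) => -[a|] /=; first exact: smooth_on_cst.
apply: (smooth_onN oO); exact: (smooth_onM oO (@snd_smooth R n O) (sA b)).
Qed.

Lemma fibre_field_smooth : smooth_on O fibre_field.
Proof.
apply: (smooth_on_pcoordP oO) => -[a|] /=; first exact: smooth_on_cst.
exact: snd_smooth.
Qed.

Variables x y : E -> E.
Hypotheses (sx : smooth_on O x) (sy : smooth_on O y).
Hypothesis x0 : forall q, O q -> q.2 = 0 -> x q = 0.
Hypothesis y0 : forall q, O q -> q.2 = 0 -> y q = 0.

(** Testing Koszul's formula on [horizontal_lift] and [fibre_field] gives the
    components of [N - 'D_x y] in that frame.  The only denominators left are
    those of the connection form on [x] and [y] and of its symmetrized
    derivative; Hadamard division of the fibre components of [x] and [y] removes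
    them. *)
Lemma covariant_extension : exists2 F : E -> E, smooth_on O F &
  (forall q, O q -> q.2 = 0 -> F q = 0) /\
  forall q, O q -> q.2 != 0 -> forall N,
    (forall u, 2 * plus_form A G (N - 'D_(x q) y q) u q =
      'D_(x q) (plus_form A G (y q) u) q + 'D_(y q) (plus_form A G (x q) u) q -
      'D_u (plus_form A G (x q) (y q)) q) ->
    N = F q.
Proof.
have [xh sxh xhE] := hadamard_division oO satO (smooth_on_pcoord None oO sx)
  (fun q Oq q0 => congr1 snd (x0 Oq q0)).
have [yh syh yhE] := hadamard_division oO satO (smooth_on_pcoord None oO sy)
  (fun q Oq q0 => congr1 snd (y0 Oq q0)).
rewrite /= in xhE yhE.
(* [al xh x] extends the connection form evaluated on [x]. *)
pose al (h : E -> R) (v : E -> E) (q : E) := h q + \sum_a (v q).1 0 a * A a q.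
(* The symmetrized derivative of the connection form on [x] and [y]. *)
pose be (q : E) := - (xh q * yh q) *+ 2 + (\sum_a (y q).1 0 a * 'D_(x q) (A a) q +
  \sum_a (x q).1 0 a * 'D_(y q) (A a) q).
pose core (e : E -> E) (q : E) := dG G (x q) (y q) (e q) q +
  dG G (y q) (x q) (e q) q - dG G (e q) (x q) (y q) q.
pose mix (e : E -> E) (q : E) := al yh y q * dA A (x q) (e q) q +
  al xh x q * dA A (y q) (e q) q.
(* Koszul's right-hand side on the frame; [be] comes with a factor that is 0 on
   horizontal vectors and 1 on the Euler field. *)
pose cB b (q : E) := core (horizontal_lift b) q + mix (horizontal_lift b) q.
pose cD (q : E) := core fibre_field q + be q + mix fibre_field q.
(* The horizontal components are solved with the inverse of (g_ab), then [Gt]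
   recovers the fibre component in the chart from the Euler component. *)
pose Ga (a : 'I_n) (q : E) := 2^-1 * \sum_b cB b q * invmx (G q) b a.
pose Gt (q : E) := q.2 * (2^-1 * cD q - \sum_a Ga a q * A a q).
pose Gam (q : E) : E := (\row_a Ga a q, Gt q).
have sal h v : smooth_on O h -> smooth_on O v -> smooth_on O (al h v).
  move=> sh sv; apply: (smooth_onD oO sh); apply: (smooth_on_sum _ oO) => a _.
  exact: (smooth_onM oO (smooth_on_row oO a sv) (sA a)).
have sbe : smooth_on O be.
  have sxy : smooth_on O (fun q => - (xh q * yh q)) :=
    smooth_onN oO (smooth_onM oO sxh syh).
  apply: (smooth_onD oO); first exact: (smooth_onD oO sxy sxy).
  apply: (smooth_onD oO); apply: (smooth_on_sum _ oO) => a _.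
    have sAx := smooth_field_derive oO (sA a) sx.
    exact: (smooth_onM oO (smooth_on_row oO a sy) sAx).
  have sAy := smooth_field_derive oO (sA a) sy.
  exact: (smooth_onM oO (smooth_on_row oO a sx) sAy).
have score e : smooth_on O e -> smooth_on O (core e).
  move=> se; apply: (smooth_onB oO); last exact: (dG_smooth oO sG se sx sy).
  exact: (smooth_onD oO (dG_smooth oO sG sx sy se) (dG_smooth oO sG sy sx se)).
have smix e : smooth_on O e -> smooth_on O (mix e).
  move=> se; apply: (smooth_onD oO).
    exact: (smooth_onM oO (sal _ _ syh sy) (dA_smooth oO sA sx se)).
  exact: (smooth_onM oO (sal _ _ sxh sx) (dA_smooth oO sA sy se)).
have sB b : smooth_on O (cB b).
  have se := horizontal_lift_smooth b.
  exact: (smooth_onD oO (score _ se) (smix _ se)).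
have sD : smooth_on O cD.
  have se := fibre_field_smooth.
  exact: (smooth_onD oO (smooth_onD oO (score _ se) sbe) (smix _ se)).
have sGa a : smooth_on O (Ga a).
  apply: (smooth_onM oO); first exact: smooth_on_cst.
  apply: (smooth_on_sum _ oO) => b _.
  exact: (smooth_onM oO (sB b) (smooth_on_invmx oO sG uG b a)).
have sGt : smooth_on O Gt.
  apply: (smooth_onM oO); first exact: snd_smooth.
  apply: (smooth_onB oO).
    by apply: (smooth_onM oO) => //; exact: smooth_on_cst.
  by apply: (smooth_on_sum _ oO) => a _; exact: (smooth_onM oO (sGa a) (sA a)).
have sGam : smooth_on O Gam.
  apply: (smooth_on_pcoordP oO) => -[a|] /=; last exact: sGt.
  by apply: (smooth_on_eq oO _ (sGa a)) => q _; rewrite mxE.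
exists (fun q => 'D_(x q) y q + Gam q).
  exact: (smooth_onD oO (smooth_field_derive_vec oO sy sx) sGam).
split=> [q Oq q0|q Oq q0 N kN].
  have core0 e : core e q = 0.
    rewrite /core /dG (x0 Oq q0) (y0 Oq q0).
    by rewrite !big1 ?addr0 ?subr0// => a _; rewrite big1// => b _ /=;
      rewrite mxE mul0r mulr0.
  have mix0 e : mix e q = 0.
    rewrite /mix /dA (x0 Oq q0) (y0 Oq q0).
    rewrite [X in _ * X + _]big1 ?mulr0 ?add0r; last first.
      by move=> a _; rewrite derive0 /= mxE mul0r mulr0 subr0.
    by rewrite big1 ?mulr0// => a _; rewrite derive0 /= mxE mul0r mulr0 subr0.
  rewrite (x0 Oq q0) derive0 add0r /Gam /Gt q0 mul0r; congr pair.
  apply/rowP => a; rewrite !mxE /Ga big1 ?mulr0// => b _.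
  by rewrite /cB core0 mix0 addr0 mul0r.
have Uq : (O `&` [set q | q.2 != 0]) q by [].
have alx : conn_form A (x q) q = al xh x q.
  by rewrite /conn_form /al xhE// mulrAC divff// mul1r.
have aly : conn_form A (y q) q = al yh y q.
  by rewrite /conn_form /al yhE// mulrAC divff// mul1r.
have beE : 'D_(x q) (conn_form A (y q)) q +
    'D_(y q) (conn_form A (x q)) q = be q.
  rewrite !(conn_form_derive oO sA)// /be xhE// yhE//.
  rewrite addrACA; congr (_ + _).
  by field.
set M := N - 'D_(x q) y q in kN.
have kM u : 2 * plus_form A G M u q =
    dG G (x q) (y q) u q + dG G (y q) (x q) u q - dG G u (x q) (y q) q +
    conn_form A u q * be q + al yh y q * dA A (x q) u q +
    al xh x q * dA A (y q) u q.
  by rewrite kN (koszul_plus_form oO sA sG)// beE alx aly.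
have MB b : 2 * \sum_a M.1 0 a * G q a b = cB b q.
  have := kM (horizontal_lift b q); rewrite conn_form_lift// mul0r addr0.
  rewrite /plus_form conn_form_lift// mulr0 addr0 /cB /mix addrA => <-.
  congr (_ * _); apply: eq_bigr => a _.
  rewrite -(sum_delta b (fun c => M.1 0 a * G q a c)); apply: eq_bigr => c _ /=.
  by rewrite mulrA mulrC [G q a c * _]mulrC.
have MD : 2 * conn_form A M q = cD q.
  have := kM (fibre_field q); rewrite conn_form_fibre// mul1r /plus_form.
  rewrite conn_form_fibre// mulr1.
  rewrite [X in 2 * (X + _)]big1 ?add0r; last first.
    move=> a _; rewrite big1// => b _.
    have -> : (fibre_field q).1 0 b = 0 by rewrite mxE.
    by rewrite !mulr0.
  by move=> ->; rewrite /cD /mix /core !addrA.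
have M1 : M.1 = \row_a Ga a q.
  have MG : M.1 *m G q = \row_b (2^-1 * cB b q).
    by apply/rowP => b; rewrite !mxE -MB mulKf.
  rewrite -[LHS](mulmxK (uG Oq)) MG; apply/rowP => a.
  rewrite !mxE /Ga mulr_sumr; apply: eq_bigr => b _.
  by rewrite !mxE mulrA.
have M2 : M.2 = Gt q.
  rewrite /Gt -MD mulKf// /conn_form.
  have <- : \sum_a M.1 0 a * A a q = \sum_a Ga a q * A a q.
    by rewrite M1; apply: eq_bigr => a _; rewrite mxE.
  by rewrite addrK mulrC divfK.
rewrite -(subrKC ('D_(x q) y q) N) -/M; congr (_ + _).
by rewrite [M]surjective_pairing M1 M2.
Qed.

End christoffel.

(** * The Levi-Civita connection on regular fields *)

Section carrollian_connection.
Variables (R : realType) (n : nat) (L : line_bundle R n) (g : tensor2 L).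
Local Notation E := ('rV[R]_n * R)%type.
Local Notation P := (punctured (L := L)).
Variables (Phi : L -> E -> E) (omega : L -> E -> R).
Hypotheses (cg : carrollian g) (cPhi : Rx_connection Phi).
Hypotheses (oPhi : connection_form Phi omega) (eg : extends_nondegenerately g).
Implicit Types (i : chart L) (p : L) (X Y : vfield L).

(** The matrix [G] extends (g_ab) over the zero section, where its invertibility
    is assumed; elsewhere it follows from the kernel of [g] being vertical. *)
Lemma g_plus_chart i : exists G : E -> 'M[R]_n,
  [/\ forall a b, smooth_on (coord i @` dom i) (fun q => G q a b),
      forall q, (coord i @` dom i) q -> G q \in unitmx
    & forall q u v, punctured_image i q ->
        tcomp i (g_plus g omega) u v q = plus_form (conn_coef omega i) G u v q].
Proof.
have [G [sG GE G0]] := eg i; exists G; split=> // [q qi|q u v qP].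
  have [q0|q0] := eqVneq q.2 0; first exact: G0.
  by rewrite GE//; apply: gab_unit.
have [qi q0] := qP.
rewrite /plus_form GE// -(tcomp_gab cg u v qP) /conn_form.
by rewrite -!(form_compE cPhi oPhi _ qP).
Qed.

Lemma g_plus_symmetric : symmetric_tensor P (g_plus g omega).
Proof.
have [[gl gs _] _] := cg; split=> [p pp u k v w|p pp u v|i u v].
- rewrite /g_plus (gl p pp u) (omega_linear cPhi oPhi pp) /GRing.scale /=; ring.
- by rewrite /g_plus (gs p pp) mulrC.
have [G [sG _ GE]] := g_plus_chart i.
have oP := @punctured_image_open _ _ _ i; rewrite -punctured_imageE.
have sp := plus_form_smooth (codom_open i) (conn_coef_smooth cPhi oPhi i) sG u v.
by apply: (smooth_on_eq oP _ sp) => q qP; rewrite GE.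
Qed.

Lemma restr_vfieldE X p : P p -> restr_vfield P X p = X p.
Proof. by move=> pp; rewrite /restr_vfield /patch mem_set. Qed.

Lemma restr_vfield0 X p : ~ P p -> restr_vfield P X p = 0.
Proof. by move=> pp; rewrite /restr_vfield /patch memNset. Qed.

Lemma restr_vfield_vcomp i X q : punctured_image i q ->
  vcomp i (restr_vfield P X) q = vcomp i X q.
Proof. by move=> /punctured_image_dom[_ qp]; rewrite /vcomp restr_vfieldE. Qed.

Lemma Vect_smooth i X : Vect setT X -> smooth_on (coord i @` dom i) (vcomp i X).
Proof. by move=> [/(_ i) + _]; rewrite setIT. Qed.

Lemma restr_vfield_Vect X : Vect setT X -> Vect P (restr_vfield P X).
Proof.
move=> VX; split=> [i|p]; last exact: restr_vfield0.
rewrite -punctured_imageE.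
have sX : smooth_on (punctured_image i) (vcomp i X).
  by apply: smooth_on_sub (Vect_smooth i VX) => q [].
apply: (smooth_on_eq (@punctured_image_open _ _ _ i) _ sX) => q qP.
by rewrite restr_vfield_vcomp.
Qed.

(** Consequently both sides of each axiom of a connection vanish on the zero
    section. *)
Lemma regular_zero X p : regular X -> ~ P p -> X p = 0.
Proof.
move=> [_ rX] np; have cp := dom_chart_at p.
have t0 : (coord (chart_at p) p).2 = 0.
  by apply/eqP; apply: contra_notT np => t0; apply/(puncturedE cp).
have := rX (chart_at p) (coord (chart_at p) p) (ex_intro2 _ _ p cp erefl) t0.
rewrite vcompE// => /(congr1 (of_chart (chart_at p) p)).
by rewrite to_chartK// linear0.
Qed.

Variable nabla : vfield L -> vfield L -> vfield L.
Hypothesis LC : levi_civita P (g_plus g omega) nabla.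

(** The chart expression of the covariant derivative, defined away from the zero
    section only, agrees there with a map that is smooth on the whole chart and
    vanishes on the zero section. *)
Lemma nabla_chart i X Y : regular X -> regular Y ->
  exists2 F : E -> E, smooth_on (coord i @` dom i) F &
    (forall q, (coord i @` dom i) q -> q.2 = 0 -> F q = 0) /\
    forall q, punctured_image i q ->
      vcomp i (nabla (restr_vfield P X) (restr_vfield P Y)) q = F q.
Proof.
move=> [VX rX] [VY rY]; have [G [sG uG GE]] := g_plus_chart i.
have oO := codom_open i.
have [F sF [F0 FE]] := covariant_extension oO
  (fun q s => @chart_image_squeeze _ _ _ i q s)
  (conn_coef_smooth cPhi oPhi i) sG uG (Vect_smooth i VX) (Vect_smooth i VY)
  (fun q qi q0 => rX i q qi q0) (fun q qi q0 => rY i q qi q0).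
exists F => //; split=> // q qP; have [qi q0] := qP.
have [qd qp] := punctured_image_dom qP.
apply: (FE q qi q0) => u.
have := koszul_chart u (@punctured_open _ _ L) qp qd g_plus_symmetric LC
  (restr_vfield_Vect VX) (restr_vfield_Vect VY).
rewrite /= !icoordK// -!/(vcomp _ _ _) !restr_vfield_vcomp//.
have oP := @punctured_image_open _ _ _ i.
have sp a b : smooth_on (punctured_image i) (plus_form (conn_coef omega i) G a b).
  exact: plus_form_smooth oO (conn_coef_smooth cPhi oPhi i) sG a b.
have dp a b v : 'D_v (tcomp i (g_plus g omega) a b) q =
    'D_v (plus_form (conn_coef omega i) G a b) q.
  apply: (open_eq_derive _ oP qP _ (smooth_diff (sp a b) qP)) => x xP.
  by rewrite GE.
have rYE x xP := esym (restr_vfield_vcomp Y (i := i) (q := x) xP).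
have dY := smooth_diff (Vect_smooth i VY) qi.
rewrite (open_eq_derive _ oP qP rYE dY).
by rewrite !dp GE.
Qed.

Lemma nabla_regular X Y : regular X -> regular Y ->
  regular (nabla (restr_vfield P X) (restr_vfield P Y)).
Proof.
move=> rX rY; have [[cV _] _ _] := LC.
have [_ N0] := cV _ _ (restr_vfield_Vect rX.1) (restr_vfield_Vect rY.1).
have z i q : (coord i @` dom i) q -> q.2 = 0 ->
    vcomp i (nabla (restr_vfield P X) (restr_vfield P Y)) q = 0.
  move=> qi q0; have qd := icoord_dom qi.
  rewrite /vcomp N0 ?linear0// => /(puncturedE qd).
  by rewrite icoordK// q0 eqxx.
split; last exact: z.
split=> [i|p /(_ I)//]; rewrite setIT.
have [F sF [F0 FE]] := nabla_chart i rX rY.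
apply: (smooth_on_eq (codom_open i) _ sF) => q qi.
have [q0|q0] := eqVneq q.2 0; first by rewrite F0// z.
by rewrite FE.
Qed.

End carrollian_connection.

Theorem proposition3p23 (R : realType) (n : nat) (L : line_bundle R n)
    (g : tensor2 L)
    (Phi : L -> 'rV[R]_n * R -> 'rV[R]_n * R)
    (omega : L -> 'rV[R]_n * R -> R)
    (nabla : vfield L -> vfield L -> vfield L)
    (carrollian_g : carrollian g)
    (connection_Phi : Rx_connection Phi)
    (omega_Phi : connection_form Phi omega)
    (g_extends : extends_nondegenerately g)
    (nabla_LC : levi_civita (punctured (L := L)) (g_plus g omega) nabla) :
  exists D : vfield L -> vfield L -> vfield L,
    (forall X Y : vfield L, regular X -> regular Y ->
       regular (D X Y) /\
       forall p : L, punctured p ->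
         D X Y p = nabla (restr_vfield (punctured (L := L)) X)
                         (restr_vfield (punctured (L := L)) Y) p) /\
    affine_connection (smooth_fun setT) (regular (L := L)) D.
Proof.
set r := restr_vfield (punctured (L := L)).
have reg X Y := nabla_regular carrollian_g connection_Phi omega_Phi g_extends
  nabla_LC (X := X) (Y := Y).
(* The fields in [Vect punctured] are 0 off their domain by convention, so the
   extension by zero is already the value of [nabla] on the restrictions. *)
exists (fun X Y => nabla (r X) (r Y)); split=> [X Y rX rY|].
  by split=> //; exact: reg.
have [[_ [addl [scal [addr leib]]]] _ _] := nabla_LC.
have V X : regular X -> Vect (punctured (L := L)) (r X).
  by move=> [VX _]; exact: restr_vfield_Vect.
have rD (X Y : vfield L) :
    r (fun p => X p + Y p) = (fun p => r X p + r Y p).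
  apply/funext => p; rewrite /r /restr_vfield /patch; case: ifP => // _.
  by rewrite addr0.
have rZ (f : L -> R) (X : vfield L) :
    r (fun p => f p *: X p) = (fun p => f p *: r X p).
  apply/funext => p; rewrite /r /restr_vfield /patch; case: ifP => // _.
  by rewrite scaler0.
have sf (f : L -> R) :
    smooth_fun setT f -> smooth_fun (punctured (L := L)) f.
  by move=> sf i; apply: smooth_on_sub (sf i); apply: image_subset => p [].
split; [exact: reg|split; [|split; [|split]]].
- by move=> U U' W rU rU' rW; rewrite rD; apply: addl; exact: V.
- by move=> f U W /sf sf' rU rW; rewrite rZ; apply: scal => //; exact: V.
- by move=> U W W' rU rW rW'; rewrite rD; apply: addr; exact: V.
move=> f U W /sf sf' rU rW; rewrite rZ leib//; [|exact: V|exact: V].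
apply/funext => p; congr (_ + _).
have [pp|np] := pselect (punctured p).
  by rewrite /lie_derive /r !restr_vfieldE.
by rewrite /r restr_vfield0// (regular_zero rW np) !scaler0.
Qed.
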